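(* Let $(W,S)$ be a Coxeter system with $S$ finite and non-empty, and let $\mathcal{P}$ be its Coxeter complex. If $W$ is finite then the integral cohomology of $\mathcal{P}$ is that of a sphere of dimension $|S|-1$. If $W$ is infinite then the integral cohomology of $\mathcal{P}$ is that of a point.
   Context: For $I\subseteq S$, $W_I$ is the subgroup of $W$ generated by $I$. The Coxeter complex $\mathcal{P}$ of $(W,S)$ is the simplicial complex whose simplices are the cosets $wW_I$ with $w\in W$ and $I\subsetneq S$, ordered by reverse inclusion: $w'W_{I'}$ is a face of $wW_I$ iff $I\subseteq I'$ and $w^{-1}w'\in W_{I'}$. The simplex $wW_I$ has dimension $|S|-|I|-1$. Its integral cohomology is the integral cohomology of its geometric realization. *)

(* Defs.v *)
From HB Require Import structures.
From mathcomp Require Import all_boot all_order all_algebra finmap.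
From mathcomp Require Import ring_quotient.
From mathcomp Require Import all_classical all_reals.
From mathcomp Require Import topology normedtype.

Set Implicit Arguments.
Unset Strict Implicit.
Unset Printing Implicit Defensive.

Import Order.TTheory GRing.Theory Num.Theory.
Import numFieldNormedType.Exports.

Local Open Scope classical_set_scope.
Local Open Scope ring_scope.

Section CoxeterComplex.
Variables (W : groupType) (S : {fset W}).

(* A Coxeter matrix on S; the value 0 encodes m(s,t) = infinity. *)
Definition coxeter_matrix (m : S -> S -> nat) : Prop :=
  [/\ forall s, m s s = 1%N,
      forall s t, m s t = m t s
    & forall s t, s != t -> m s t != 1%N].

(* W = < S | (s t)^m(s,t) = 1 >, as the universal property of this
   presentation. No relation is imposed when m s t = 0, as x ^+ 0 = 1. *)
Definition coxeter_presentation (m : S -> S -> nat) : Prop :=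
  (forall s t : S, (val s * val t) ^+ m s t = 1)%g /\
  forall (G : groupType) (f : S -> G),
    (forall s t : S, (f s * f t) ^+ m s t = 1)%g ->
    exists! h : W -> G,
      {morph h : x y / (x * y)%g} /\ forall s : S, h (val s) = f s.

Definition coxeter_system : Prop :=
  exists m : S -> S -> nat, coxeter_matrix m /\ coxeter_presentation m.

Definition is_subgroup (H : set W) : Prop :=
  H 1%g /\ forall x y, H x -> H y -> H (x * y^-1)%g.

Definition parabolic (I : {fset W}) : set W := smallest is_subgroup [set` I].

Definition left_coset (w : W) (H : set W) : set W := [set (w * x)%g | x in H].

Definition coxeter_simplex_of_dim (d : nat) (sigma : set W) : Prop :=
  exists w (I : {fset W}),
    [/\ (I `<` S)%fset, (#|` S| - #|` I| - 1)%N = d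
      & sigma = left_coset w (parabolic I)].

Definition coxeter_simplex (sigma : set W) : Prop :=
  exists d, coxeter_simplex_of_dim d sigma.

(* tau is a face of sigma: simplices are ordered by reverse inclusion. *)
Definition coxeter_face (tau sigma : set W) : Prop := sigma `<=` tau.

(* The vertices of sigma are its 0-dimensional faces, and the complex is given
   as the family of the vertex sets of its simplices. *)
Definition coxeter_vertices (sigma : set W) : set (set W) :=
  [set v | coxeter_simplex_of_dim 0 v /\ coxeter_face v sigma].

Definition coxeter_complex : set (set (set W)) :=
  [set coxeter_vertices sigma | sigma in coxeter_simplex].

End CoxeterComplex.

Section Realization.
Variables (R : realType) (V : choiceType) (K : set (set V)).

Definition weight_support (p : V -> R) : set V := [set v | p v != 0].

Record realization := Realization {
  weight :> V -> R;
  weight_ge0 : forall v, 0 <= weight v;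
  weight_simplex : K (weight_support weight);
  weight_sum : \sum_(v \in [set: V]) weight v = 1 }.

HB.instance Definition _ := gen_eqMixin realization.
HB.instance Definition _ := gen_choiceMixin realization.

Definition closed_simplex (s : set V) : set realization :=
  [set p | weight_support p `<=` s].

(* Each closed simplex carries the topology of pointwise convergence of the
   barycentric coordinates, and the realization the coherent (weak) topology. *)
Definition realization_open : set (set realization) :=
  [set U | forall s, K s -> exists2 O : set {ptws V -> R}, open O &
     U `&` closed_simplex s =
     [set p : realization | O (p : V -> R)] `&` closed_simplex s].

Let openTr : realization_open setT.
Proof. by move=> s _; exists setT; [exact: openT|]. Qed.

Let openIr : setI_closed realization_open.
Proof.
move=> A B oA oB s Ks.
have [O oO AO] := oA s Ks; have [P oP BP] := oB s Ks.
exists (O `&` P); first exact: openI.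
by rewrite setIIl AO BP -setIIl.
Qed.

Let open_bigUr (I : Type) (f : I -> set realization) :
  (forall i, realization_open (f i)) -> realization_open (\bigcup_i f i).
Proof.
move=> of_ s Ks.
have /choice[O OP] i : exists O : set {ptws V -> R}, open O /\
    f i `&` closed_simplex s =
    [set p : realization | O (p : V -> R)] `&` closed_simplex s.
  by have [O oO fO] := of_ i s Ks; exists O.
exists (\bigcup_i O i).
  by apply: bigcup_open => i _; have [] := OP i.
rewrite setI_bigcupl (eq_bigcupr (fun i _ => (OP i).2)) -setI_bigcupl.
by [].
Qed.

HB.instance Definition _ :=
  isOpenTopological.Build realization openTr openIr open_bigUr.

End Realization.

Section SingularCohomology.
Variable R : realType.

Definition std_simplex (n : nat) : set 'rV[R]_n.+1 :=
  [set x | (forall i, 0 <= x 0 i) /\ \sum_i x 0 i = 1].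
Arguments std_simplex n : clear implicits.

(* The i-th face: insertion of a zero coordinate at position i. *)
Definition face_fun (n : nat) (i : 'I_n.+2) (x : 'rV[R]_n.+1) : 'rV[R]_n.+2 :=
  \row_j (if unlift i j is Some k then x 0 k else 0).

Lemma face_fun_simplex n (i : 'I_n.+2) (x : std_simplex n) :
  face_fun i (set_val x) \in std_simplex n.+1.
Proof.
case: x => x /=; rewrite set_valE /= => /set_mem[x0 x1]; apply/mem_set; split.
  by move=> j; rewrite mxE; case: unlift.
rewrite (bigD1 i)//= mxE unlift_none add0r.
rewrite (reindex_omap (lift i) (unlift i)) /=; last first.
  by move=> j; rewrite eq_sym => /unlift_some[k -> ->].
rewrite -x1; apply: eq_big => [j|j _].
  by rewrite liftK eqxx eq_sym neq_lift.
by rewrite mxE liftK.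
Qed.

Definition face_map n (i : 'I_n.+2) (x : std_simplex n) : std_simplex n.+1 :=
  SigSub (face_fun_simplex i x).

Lemma face_fun_continuous n (i : 'I_n.+2) : continuous (@face_fun n i).
Proof.
move=> x B [C nC CB]; have FF := @nbhs_filter _ x.
have H r j : \forall y \near x, C r j (face_fun i y r j).
  have cj : continuous (fun y : 'rV[R]_n.+1 =>
      if unlift i j is Some k then y 0 k else 0).
    by case: unlift => [k|]; [exact: coord_continuous|exact: cst_continuous].
  have /cj : nbhs (if unlift i j is Some k then x 0 k else 0) (C r j).
    by have := nC r j; rewrite mxE.
  by move=> h; apply: (@filterS _ _ FF _ _ _ h) => y; rewrite /face_fun mxE (ord1 r).
have := @filter_forall _ _ _ _ FF (fun r => @filter_forall _ _ _ _ FF (H r)).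
by move=> h; apply: (@filterS _ _ FF _ _ _ h) => y; exact: CB.
Qed.

Lemma face_map_continuous n (i : 'I_n.+2) : continuous (@face_map n i).
Proof.
apply/continuousP => _ [A oA <-].
rewrite -[X in open X]/((fun x => face_fun i (set_val x)) @^-1` A).
apply: open_comp oA => x _ /=.
apply: (@continuous_comp _ _ _ set_val (face_fun i)).
  exact: initial_continuous.
exact: face_fun_continuous.
Qed.

HB.instance Definition _ n (i : 'I_n.+2) :=
  @isContinuous.Build _ _ (@face_map n i) (@face_map_continuous n i).

Variable X : topologicalType.

Definition singular_simplex (n : nat) := continuousType (std_simplex n) X.

(* Integral singular cochains, Hom(C_n(X), Z), as functions on the basis of
   singular simplices. *)
Definition cochain (n : nat) : Type := singular_simplex n -> int.

HB.instance Definition _ n := GRing.Zmodule.on (cochain n).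

Definition coboundary n (c : cochain n) : cochain n.+1 :=
  fun s => \sum_(i < n.+2)
    (-1) ^+ i * c [the continuousType _ _ of s \o @face_map n i].

Definition is_cocycle n : {pred cochain n} := [pred c | `[< coboundary c = 0 >]].
Arguments is_cocycle n : clear implicits.

Definition is_coboundary n : cochain n -> Prop :=
  if n is n'.+1 then fun c => exists b : cochain n', c = coboundary b
  else fun c => c = 0.

Lemma coboundaryB n (b c : cochain n) :
  coboundary (b - c) = coboundary b - coboundary c.
Proof.
apply/funext => s; rewrite /coboundary !fctE -sumrB.
by apply: eq_bigr => i _; rewrite mulrBr.
Qed.

Lemma coboundary0 n : coboundary (0 : cochain n) = 0.
Proof. by rewrite -(subrr 0) coboundaryB subrr. Qed.

Lemma is_cocycle_zmod n : zmod_closed (is_cocycle n).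
Proof.
split=> [|b c]; first exact/asboolP/coboundary0.
by move=> /asboolP zb /asboolP zc; apply/asboolP; rewrite coboundaryB zb zc subrr.
Qed.

HB.instance Definition _ n :=
  GRing.isZmodClosed.Build (cochain n) (is_cocycle n) (is_cocycle_zmod n).

Definition cocycle (n : nat) := {c : cochain n | c \in is_cocycle n}.
HB.instance Definition _ n := [isSub of cocycle n for sval].
HB.instance Definition _ n := [Choice of cocycle n by <:].
HB.instance Definition _ n := [SubChoice_isSubZmodule of cocycle n by <:].

Definition coboundaries n : {pred cocycle n} :=
  [pred c | `[< is_coboundary (val c) >]].
Arguments coboundaries n : clear implicits.

Lemma coboundaries_zmod n : zmod_closed (coboundaries n).
Proof.
split=> [|b c].
  apply/asboolP; case: n => [|n] //=.
  by exists 0; rewrite coboundary0.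
move=> /asboolP zb /asboolP zc; apply/asboolP; move: zb zc; rewrite raddfB /=.
case: n b c => [|n] b c /=; first by move=> -> ->; rewrite subrr.
by move=> [x ->] [y ->]; exists (x - y); rewrite coboundaryB.
Qed.

HB.instance Definition _ n :=
  GRing.isZmodClosed.Build (cocycle n) (coboundaries n) (coboundaries_zmod n).

Definition cohomology (n : nat) : zmodType := Quotient.quot (coboundaries n).

End SingularCohomology.

Definition same_cohomology (R : realType) (X Y : topologicalType) : Prop :=
  forall n, exists f : {additive cohomology R X n -> cohomology R Y n},
    bijective f.

Definition sphere (R : realType) (d : nat) : set 'rV[R]_d.+1 :=
  [set x | \sum_i x 0 i ^+ 2 = 1].
Arguments sphere R d : clear implicits.

Definition point_space (R : realType) : set R := [set 0].
Arguments point_space R : clear implicits.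

(* Main.v *)
Require Import Defs.
From HB Require Import structures.
From mathcomp Require Import all_boot all_order all_algebra finmap.
From mathcomp Require Import ring lra zify ring_quotient generic_quotient.
From mathcomp Require Import all_classical all_reals.
From mathcomp Require Import topology normedtype trigo realfun.

Set Implicit Arguments.
Unset Strict Implicit.
Unset Printing Implicit Defensive.

Import Order.TTheory GRing.Theory Num.Theory.
Import numFieldNormedType.Exports.

Local Open Scope classical_set_scope.
Local Open Scope ring_scope.

(** The dual of the geometric representation of W realises the Coxeter complex as
    the complex of faces of the Tits cone, the union of the translates of the
    closed fundamental chamber C of R^S: the vertex w W_(S \ s) is sent to w e_s
    and the realization is mapped linearly on simplices.  This map is a bijection
    onto the Tits cone without 0, up to positive scaling, and its inverse is
    continuous on every finite union of chambers.

    If W is finite, the longest element sends C to -C, and since the Tits cone is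
    convex it is the whole space: radial projection is a homeomorphism from the
    realization to the sphere.

    If W is infinite, no negative multiple of an interior point of C lies in the
    Tits cone, so contracting linearly to such a point avoids 0.  A segment from C
    to wC only meets chambers of length at most that of w, and a compact set of
    the realization lies in finitely many chambers, so the contraction is
    continuous on each singular simplex.  The resulting cone construction on
    singular simplices makes the constant map act as the identity in
    cohomology. *)

(** * Coxeter groups and word length *)

Section SelfBijections.
Variable T : Type.

Record selfbij := SelfBij {
  sb_fun :> T -> T;
  sb_inv : T -> T;
  sb_funK : cancel sb_fun sb_inv;
  sb_invK : cancel sb_inv sb_fun }.

HB.instance Definition _ := gen_eqMixin selfbij.
HB.instance Definition _ := gen_choiceMixin selfbij.

Lemma selfbijP (u v : selfbij) : u =1 v -> u = v.
Proof.
move=> uv; have iuv : sb_inv u =1 sb_inv v.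
  by move=> x; rewrite -{1}(sb_invK v x) -uv sb_funK.
case: u v uv iuv => [f g fK gK] [f' g' fK' gK'] /= /funext ff' /funext gg'.
by subst f' g'; congr SelfBij; exact: Prop_irrelevance.
Qed.

Definition sb_one := @SelfBij idfun idfun (fun=> erefl) (fun=> erefl).
Definition sb_mul (u v : selfbij) := @SelfBij (u \o v) (sb_inv v \o sb_inv u)
  (can_comp (sb_funK u) (sb_funK v)) (can_comp (sb_invK v) (sb_invK u)).
Definition sb_opp (u : selfbij) := SelfBij (sb_invK u) (sb_funK u).

Lemma sb_mulA : associative sb_mul. Proof. by move=> u v w; exact: selfbijP. Qed.
Lemma sb_mul1 : left_id sb_one sb_mul. Proof. by move=> u; exact: selfbijP. Qed.
Lemma sb_mul1r : right_id sb_one sb_mul. Proof. by move=> u; exact: selfbijP. Qed.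
Lemma sb_mulV : left_inverse sb_one sb_opp sb_mul.
Proof. by move=> u; apply: selfbijP => x; exact: sb_funK. Qed.
Lemma sb_mulVr : right_inverse sb_one sb_opp sb_mul.
Proof. by move=> u; apply: selfbijP => x; exact: sb_invK. Qed.

HB.instance Definition _ :=
  isGroup.Build selfbij sb_mulA sb_mul1 sb_mul1r sb_mulV sb_mulVr.

Lemma sb_expE (u : selfbij) k x : (u ^+ k)%g x = iter k u x.
Proof. by elim: k => // k IH; rewrite expgS iterS -IH. Qed.

End SelfBijections.

Section CoxeterPresentation.
Variables (W : groupType) (n : nat) (g : 'I_n.+1 -> W).
Variable m : 'I_n.+1 -> 'I_n.+1 -> nat.

(** Generators are indexed by ordinals so that R^S becomes a space of row vectors. *)
Definition indexed_coxeter_system :=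
  [/\ [/\ forall s, m s s = 1%N, forall s t, m s t = m t s
        & forall s t, s != t -> m s t != 1%N],
      forall s t, ((g s * g t) ^+ m s t = 1)%g &
      forall (G : groupType) (f : 'I_n.+1 -> G),
        (forall s t, (f s * f t) ^+ m s t = 1)%g ->
        exists! h : W -> G,
          {morph h : x y / (x * y)%g} /\ forall s, h (g s) = f s].

Hypothesis gP : indexed_coxeter_system.

Let m_diag : forall s, m s s = 1%N. Proof. by case: gP => [[]]. Qed.
Let braid : forall s t, ((g s * g t) ^+ m s t = 1)%g.
Proof. by case: gP. Qed.

Lemma universal_map (G : groupType) (f : 'I_n.+1 -> G) :
  (forall s t, (f s * f t) ^+ m s t = 1)%g ->
  exists h : W -> G,
    {morph h : x y / (x * y)%g} /\ forall s, h (g s) = f s.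
Proof. by case: gP => _ _ /[apply] -[h [hP _]]; exists h. Qed.

Lemma genK s : (g s * g s = 1)%g.
Proof. by have := braid s s; rewrite m_diag expg1. Qed.

Lemma genV s : (g s)^-1%g = g s.
Proof. exact/mulg1_eq/genK. Qed.

Lemma gen_mulK s w : (g s * (g s * w) = w)%g.
Proof. by rewrite mulgA genK mul1g. Qed.

Definition word_prod (l : seq 'I_n.+1) : W := foldr (fun s w => g s * w)%g 1%g l.

Lemma word_prod_cat l l' : word_prod (l ++ l') = (word_prod l * word_prod l')%g.
Proof. by elim: l => [|s l /= ->]; rewrite ?mul1g ?mulgA. Qed.

Lemma word_prodV l : (word_prod l)^-1%g = word_prod (rev l).
Proof.
elim: l => [|s l IH]; first by rewrite invg1.
by rewrite rev_cons -cats1 word_prod_cat /= invgM genV IH mulg1.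
Qed.

Definition generated : pred W := [pred w | `[< exists l, word_prod l = w >]].

Lemma generated_group : group_closed generated.
Proof.
split; first by apply/asboolP; exists [::].
move=> _ _ /asboolP[l <-] /asboolP[l' <-]; apply/asboolP.
by exists (l ++ rev l'); rewrite word_prod_cat word_prodV.
Qed.

Definition generated_type := {w : W | generated w}.
HB.instance Definition _ := SubChoice.on generated_type.
HB.instance Definition _ :=
  @SubChoice_isSubGroup.Build W generated generated_type generated_group.

(* The universal property splits the inclusion of the subgroup generated by the
   generators. *)
Lemma word_prod_surj w : exists l, word_prod l = w.
Proof.
have gg s : generated (g s) by apply/asboolP; exists [:: s]; rewrite /= mulg1.
pose f s : generated_type := exist _ (g s) (gg s).
have f_mul : {morph (val : generated_type -> W) : x y / (x * y)%g}.
  by move=> x y; rewrite valM.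
have [|h [hM hg]] := @universal_map generated_type f.
  move=> s t; apply: val_inj; rewrite val1 -(braid s t).
  by elim: (m s t) => [|k IH]; rewrite ?val1 // !expgS !valM -IH.
have [_ _ /(_ _ g braid) [h0 [_ h0u]]] := gP.
have h0h : h0 = val \o h by apply: h0u; split=> [x y|s] /=; rewrite ?hM ?hg.
have h0id : h0 = idfun by exact: h0u.
have -> : w = val (h w) by rewrite -[LHS]/(idfun w) -h0id h0h.
by have /asboolP := valP (h w).
Qed.

Let has_length w k := `[< exists l, size l = k /\ word_prod l = w >].

Let has_length_ex w : exists k, has_length w k.
Proof. by have [l <-] := word_prod_surj w; exists (size l); apply/asboolP; exists l. Qed.

Definition len w := ex_minn (has_length_ex w).

Lemma len_word w : exists l, size l = len w /\ word_prod l = w.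
Proof. by rewrite /len; case: ex_minnP => k /asboolP. Qed.

Lemma len_word_prod l : (len (word_prod l) <= size l)%N.
Proof. by rewrite /len; case: ex_minnP => k _; apply; apply/asboolP; exists l. Qed.

Lemma len0 w : (len w = 0)%N -> w = 1%g.
Proof. by have [[|s l] [<- <-]] := len_word w. Qed.

Lemma len1 : len 1 = 0%N.
Proof. by apply/eqP; rewrite -leqn0 (len_word_prod [::]). Qed.

Lemma len_gen_mul s w : (len (g s * w) <= (len w).+1)%N.
Proof. by have [l [<- <-]] := len_word w; exact: (len_word_prod (s :: l)). Qed.

Lemma len_gen_mul_ge s w : (len w <= (len (g s * w)).+1)%N.
Proof. by rewrite -{1}(gen_mulK s w) len_gen_mul. Qed.

(** The sign character: every generator is sent to the transposition of [bool], which satisfies all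
    the relations. *)
Lemma len_parity s w : odd (len (g s * w)) = ~~ odd (len w).
Proof.
pose f (_ : 'I_n.+1) : selfbij bool := SelfBij negbK negbK.
have [|h [hM hg]] := @universal_map (selfbij bool) f.
  move=> s' t; have -> : (f s' * f t = 1)%g by apply: selfbijP => -[].
  by rewrite expg1n.
have h1 : h 1%g = 1%g by apply: (mulgI (h 1%g)); rewrite -hM !mulg1.
have hE w' : h w' true = ~~ odd (len w').
  have [l [<- <-]] := len_word w'; elim: l => [|t l IH] /=; first by rewrite h1.
  by rewrite hM hg -IH.
by apply: negb_inj; rewrite -hE hM hg /= hE.
Qed.

Lemma len_ascent_or_descent s w :
  len (g s * w) = (len w).+1 \/ len w = (len (g s * w)).+1.
Proof.
have := len_gen_mul s w; have := len_gen_mul_ge s w; have := len_parity s w.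
move: (len _) (len w) => a b odd_a ba ab.
have : a <> b by move=> e; move: odd_a; rewrite e; case: odd.
lia.
Qed.

Lemma len_descent_ex w : w <> 1%g -> exists s, len w = (len (g s * w)).+1.
Proof.
have [l [sl el]] := len_word w; case: l sl el => [|s l] /= sl el w1.
  by case: w1; rewrite -el.
exists s; have [e|//] := len_ascent_or_descent s w.
by have := len_word_prod l; move: e; rewrite -sl -el gen_mulK; lia.
Qed.

Lemma finite_len_le N : finite_set [set w | (len w <= N)%N].
Proof.
have fin : finite_set (\bigcup_(k < N.+1)
    ((word_prod \o val) @` [set: k.-tuple 'I_n.+1])).
  by apply: bigcup_finite => // k _; exact/finite_image.
apply: sub_finite_set fin => w /= wN; have [l [sl <-]] := len_word w.
by exists (len w) => //; exists (tcast sl (in_tuple l)); rewrite //= val_tcast.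
Qed.

End CoxeterPresentation.

(** * The Tits cone *)

Section Chebyshev.
Variable R : realType.

(** This is -2B(e_s, e_t) for the canonical bilinear form B of the Coxeter group; in particular it
    is -2 at m = 1. *)
Definition dihedral_coef (m : nat) : R :=
  if m == 0%N then 2 else 2 * cos (pi / m%:R).

Lemma dihedral_angle m : (1 < m)%N -> 0 < (pi : R) / m%:R < pi.
Proof.
move=> m1; have m0 : 0 < m%:R :> R by rewrite ltr0n; lia.
rewrite divr_gt0 ?pi_gt0//= ltr_pdivrMr// ltr_pMr ?pi_gt0//.
by rewrite ltr1n.
Qed.

Lemma dihedral_coef_lt2 m : (1 < m)%N -> 4 - dihedral_coef m ^+ 2 != 0.
Proof.
move=> m1; have /andP[t0 tpi] := dihedral_angle m1.
have s0 : 0 < sin (pi / m%:R : R) by rewrite sin_gt0_pi// t0.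
have /negbTE m0 : m != 0%N by lia.
rewrite /dihedral_coef m0.
have := cos2Dsin2 (pi / m%:R : R); set c := cos _; set s := sin _ => e.
have -> : 4 - (2 * c) ^+ 2 = (2 * s) ^+ 2 by rewrite !exprMn -[s ^+ 2](addKr (c ^+ 2)) e; ring.
by rewrite sqrf_eq0 mulf_neq0// gt_eqF.
Qed.

(* [p k = sin (k * pi / m) / sin (pi / m)], and [p k = k] when [m] encodes
   infinity. *)
Lemma dihedral_seq m : m != 1%N -> exists p : nat -> R,
  [/\ p 0%N = 0, p 1%N = 1,
      forall k, p k.+2 = dihedral_coef m * p k.+1 - p k,
      forall k, (m == 0)%N || (k <= m)%N -> 0 <= p k &
      m != 0%N -> p (2 * m)%N = 0 /\ p (2 * m).+1 = 1].
Proof.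
move=> m1; rewrite /dihedral_coef; case: eqP => [m0|/eqP m0].
  exists (fun k => k%:R); split => // k.
  by rewrite -[k.+2]addn2 -[k.+1]addn1 !natrD; ring.
have {}m1 : (1 < m)%N by lia.
have /andP[t0 tpi] := dihedral_angle m1.
have mt : m%:R * (pi / m%:R) = pi :> R.
  by rewrite mulrCA divff ?mulr1// pnatr_eq0.
move: (pi / m%:R : R) mt t0 tpi => t mt t0 tpi.
have s0 : 0 < sin t by rewrite sin_gt0_pi// t0.
have sn0 : sin t != 0 by rewrite gt_eqF.
exists (fun k => sin (k%:R * t) / sin t); split => [|||k /= km|_].
- by rewrite mul0r sin0 mul0r.
- by rewrite mul1r divff.
- move=> k; rewrite mulrA -mulrBl; congr (_ / _).
  have -> : k.+2%:R * t = k.+1%:R * t + t by rewrite -[k.+2]addn1 natrD; ring.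
  have -> : k%:R * t = k.+1%:R * t - t by rewrite -[k.+1]addn1 natrD; ring.
  by rewrite sinD sinB; ring.
- apply: divr_ge0 (ltW s0); apply: sin_ge0_pi; rewrite mulr_ge0 ?ler0n ?(ltW t0)//=.
  by rewrite -mt ler_pM2r// ler_nat.
- have e2 : (2 * m)%N%:R * t = pi *+ 2 by rewrite natrM -mulrA mt mulr_natl.
  split; first by rewrite e2 sin2pi mul0r.
  by rewrite -addn1 natrD mulrDl mul1r e2 addrC sinD2pi divff.
Qed.

End Chebyshev.

Section TitsRepresentation.
Variables (R : realType) (W : groupType) (n : nat) (g : 'I_n.+1 -> W).
Variable m : 'I_n.+1 -> 'I_n.+1 -> nat.
Hypothesis gP : indexed_coxeter_system g m.

Let m_diag : forall s, m s s = 1%N. Proof. by case: gP => [[]]. Qed.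
Let m_sym : forall s t, m s t = m t s. Proof. by case: gP => [[]]. Qed.
Let m_neq1 : forall s t, s != t -> m s t != 1%N.
Proof. by case: gP => [[]]. Qed.
Let braid : forall s t, ((g s * g t) ^+ m s t = 1)%g.
Proof. by case: gP. Qed.

Notation V := 'rV[R]_n.+1.
Implicit Types (x y z : V) (s t : 'I_n.+1).

Let c s t : R := dihedral_coef R (m s t).

Let c_diag s : c s s = -2.
Proof. by rewrite /c /dihedral_coef m_diag /= divr1 cospi; ring. Qed.

Let c_sym s t : c s t = c t s. Proof. by rewrite /c m_sym. Qed.

Let root s : V := \row_t c s t.

(* The action of s on the dual of the geometric representation, in the
   coordinates given by the simple roots. *)
Definition reflection s x : V := x + x 0 s *: root s.

Lemma reflection_coord s x t : reflection s x 0 t = x 0 t + x 0 s * c s t.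
Proof. by rewrite !mxE. Qed.

Lemma reflection_diag s x : reflection s x 0 s = - x 0 s.
Proof. by rewrite reflection_coord c_diag; ring. Qed.

Lemma reflectionK s : involutive (reflection s).
Proof.
by move=> x; apply/rowP => t; rewrite reflection_coord reflection_diag
  reflection_coord; ring.
Qed.

Lemma reflectionD s x y : reflection s (x + y) = reflection s x + reflection s y.
Proof. by rewrite /reflection mxE scalerDl addrACA. Qed.

Lemma reflectionZ s a x : reflection s (a *: x) = a *: reflection s x.
Proof. by rewrite /reflection mxE scalerDr scalerA. Qed.

Definition reflection_bij s : selfbij V := SelfBij (reflectionK s) (reflectionK s).

(** The s and t coordinates of the two roots form a matrix of determinant 4 - c^2, which is nonzero
    for finite m. So V is the plane of the two roots plus the vectors fixed by both reflections. *)
Let dihedral_decomposition s t : (1 < m s t)%N -> forall x,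
  exists y a b, [/\ y 0 s = 0, y 0 t = 0 & x = y + a *: root s + b *: root t].
Proof.
move=> m1 x; have := @dihedral_coef_lt2 R _ m1; rewrite -/(c s t) => D0.
pose a := - (2 * x 0 s + c s t * x 0 t) / (4 - c s t ^+ 2).
pose b := - (c s t * x 0 s + 2 * x 0 t) / (4 - c s t ^+ 2).
exists (x - a *: root s - b *: root t), a, b; split.
- by rewrite !mxE c_diag [c t s]c_sym /a /b; field.
- by rewrite !mxE c_diag /a /b; field.
- by rewrite addrAC subrK subrK.
Qed.

Lemma reflection_braid s t :
  ((reflection_bij s * reflection_bij t) ^+ m s t = 1)%g.
Proof.
apply: selfbijP => x; rewrite sb_expE.
have [->|m0] := eqVneq (m s t) 0%N; first by [].
have [st|st] := eqVneq s t.
  by rewrite -st m_diag /= reflectionK.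
have m1 : (1 < m s t)%N by have := m_neq1 st; lia.
have [p [p0 p1 pS _ /(_ m0) [p2m p2m1]]] := @dihedral_seq R _ (m_neq1 st).
have [y [a [b [ys yt ->]]]] := dihedral_decomposition m1 x.
(* The solution of the Chebyshev recurrence with q 0 = b and q 1 = a. Each reflection advances it by
   one index, so (st)^m advances it by 2m, which is a period. *)
pose q k := a * p k + b * (p k.+1 - c s t * p k).
have qS k : q k.+2 = c s t * q k.+1 - q k by rewrite /q !pS -/(c s t); ring.
have qE k : iter k (reflection_bij s * reflection_bij t)%g
    (y + a *: root s + b *: root t) =
    y + q (2 * k).+1 *: root s + q (2 * k)%N *: root t.
  elim: k => [|k IH].
    by rewrite /q muln0 /= pS -/(c s t) p0 p1; congr (_ + _ *: _ + _ *: _); ring.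
  rewrite iterS {}IH /= mulnS !qS.
  apply/rowP => u; rewrite !reflection_coord !mxE ys yt !c_diag [c t s]c_sym.
  by rewrite -/(c s t); ring.
by rewrite qE /q pS p2m p2m1 -/(c s t) /=; congr (_ + _ *: _ + _ *: _); ring.
Qed.

Let act_ex := universal_map gP reflection_braid.

Definition act : W -> selfbij V := sval (cid act_ex).

Lemma actM u w x : act (u * w)%g x = act u (act w x).
Proof. by rewrite /act; case: cid => h /= [-> _]. Qed.

Lemma act_gen s x : act (g s) x = reflection s x.
Proof. by rewrite /act; case: cid => h /= [_ ->]. Qed.

Lemma act1 x : act 1%g x = x.
Proof. by apply: (can_inj (sb_funK (act 1%g))); rewrite -actM mulg1. Qed.

Lemma actK w x : act w^-1%g (act w x) = x.
Proof. by rewrite -actM mulVg act1. Qed.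

Lemma actKV w x : act w (act w^-1%g x) = x.
Proof. by rewrite -actM mulgV act1. Qed.

Lemma actD w x y : act w (x + y) = act w x + act w y.
Proof.
have [l <-] := word_prod_surj gP w; elim: l => [|s l IH] /=; first by rewrite !act1.
by rewrite !actM IH !act_gen reflectionD.
Qed.

Lemma actZ w a x : act w (a *: x) = a *: act w x.
Proof.
have [l <-] := word_prod_surj gP w; elim: l => [|s l IH] /=; first by rewrite !act1.
by rewrite !actM IH !act_gen reflectionZ.
Qed.

Lemma act0 w : act w 0 = 0.
Proof. by rewrite -[X in act w X](scale0r 0) actZ scale0r. Qed.

Lemma actN w x : act w (- x) = - act w x.
Proof. by rewrite -scaleN1r actZ scaleN1r. Qed.

Lemma act_sum w (I : Type) (r : seq I) (P : pred I) (F : I -> V) :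
  act w (\sum_(i <- r | P i) F i) = \sum_(i <- r | P i) act w (F i).
Proof. by rewrite (big_morph _ (actD w) (act0 w)). Qed.

Lemma act_genE s x t : act (g s) x 0 t = x 0 t + x 0 s * c s t.
Proof. by rewrite act_gen reflection_coord. Qed.

Lemma act_gen_diag s x : act (g s) x 0 s = - x 0 s.
Proof. by rewrite act_gen reflection_diag. Qed.

Lemma act_gen_fix s x : x 0 s = 0 -> act (g s) x = x.
Proof. by move=> xs; rewrite act_gen /reflection xs scale0r addr0. Qed.

(** The alternating product s t s ... with k letters, an element of the dihedral subgroup generated
    by s and t. *)
Fixpoint alt s t k : W := if k is k'.+1 then (g s * alt t s k')%g else 1%g.

Lemma alt_cat s t j k :
  alt s t (j + k) =
  (alt s t j * (if odd j then alt t s k else alt s t k))%g.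
Proof.
elim: j s t => [|j IH] s t /=; first by rewrite mul1g.
by rewrite IH mulgA if_neg.
Qed.

Lemma altV s t k :
  (alt s t k)^-1%g = if odd k then alt s t k else alt t s k.
Proof.
elim: k s t => [|k IH] s t; first by rewrite invg1.
rewrite /= invgM (genV gP) IH -[in RHS]/(alt s t k.+1) -[in RHS]/(alt t s k.+1).
rewrite -addn1 !alt_cat /=; case: (odd k) => /=; by rewrite mulg1.
Qed.

Lemma alt_double s t k : alt s t (k + k) = ((g s * g t) ^+ k)%g.
Proof.
elim: k => // k IH; rewrite addSn addnS expgS -IH /=.
by rewrite mulgA.
Qed.

Lemma alt_braid s t : alt s t (m s t) = alt t s (m s t).
Proof.
have := braid s t; rewrite -alt_double alt_cat => e.
apply: (mulIg (alt t s (m s t))^-1%g); rewrite mulgV altV.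
by rewrite -e; case: odd.
Qed.

(** The rank two case of [act_ascent]: the coordinate is a combination of those of x with
    coefficients [p k] and [p k.+1]. *)
Lemma alt_coord_ge0 s t x k : s != t -> 0 <= x 0 s -> 0 <= x 0 t ->
  (m s t == 0)%N || (k < m s t)%N -> 0 <= act (alt t s k) x 0 s.
Proof.
move=> st xs xt km.
have [p [p0 p1 pS p_ge0 _]] := @dihedral_seq R _ (m_neq1 st).
have step u v j : act (alt v u j.+2) x 0 u =
    act (alt u v j.+1) x 0 v * c v u - act (alt v u j) x 0 u.
  rewrite -[alt v u j.+2]/(g v * (g u * alt v u j))%g.
  rewrite -[alt u v j.+1]/(g u * alt v u j)%g.
  by rewrite actM act_genE !actM act_gen_diag addrC.
have coord j u v : c v u = c s t ->
    act (alt v u j) x 0 u =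
      if odd j then p j * x 0 u + p j.+1 * x 0 v else p j.+1 * x 0 u + p j * x 0 v.
  elim/ltn_ind: j u v => -[|[|j]] IH u v cvu.
  - by rewrite /= act1 p0 p1; ring.
  - by rewrite /= mulg1 act_genE cvu pS p0 p1 -/(c s t); ring.
  - rewrite step !IH // 1?c_sym // [c u v]c_sym cvu /= negbK !pS -/(c s t).
    by case: (odd j) => /=; ring.
(* The strict bound k < m is what makes [p k.+1] non-negative as well. *)
have pk : 0 <= p k by apply: p_ge0; lia.
have pk1 : 0 <= p k.+1 by apply: p_ge0; lia.
by rewrite coord ?(c_sym t)//; case: odd; rewrite addr_ge0// mulr_ge0.
Qed.

Lemma len_alt_mul s t k w : (len gP (alt s t k * w) <= k + len gP w)%N.
Proof.
elim: k s t => [|k IH] s t; first by rewrite mul1g.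
rewrite /= -mulgA; apply: leq_trans (len_gen_mul _ _ _) _.
by rewrite addSn ltnS.
Qed.

(** Descents t, s, t, ... are removed from the left of w in turn, until the letter whose turn it is
    becomes an ascent. *)
Lemma alt_strip s t w : exists k v,
  [/\ w = (alt t s k * v)%g, (k + len gP v = len gP w)%N
    & len gP (g (if odd k then s else t) * v)%g = (len gP v).+1].
Proof.
move e : (len gP w) => N; elim: N s t w e => [|N IH] s t w e.
  exists 0%N, w; rewrite mul1g e; split=> //=.
  by have [->|] := len_ascent_or_descent gP t w; rewrite e.
have [et|et] := len_ascent_or_descent gP t w.
  by exists 0%N, w; split; rewrite ?mul1g.
have [|k [v [ev ek kv]]] := IH t s (g t * w)%g; first by lia.
exists k.+1, v; split.
- by rewrite /= -mulgA -ev (gen_mulK gP).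
- by rewrite addSn ek.
- by rewrite /=; case: (odd k) kv.
Qed.

Definition chamber : set V := [set x | forall s, 0 <= x 0 s].

(** Tits's lemma, by induction on length. Stripping from w the alternating word in t and s that
    starts with a descent t leaves a shorter v for which s and t are both ascents, so induction
    applies to v, and the rank two case brings the result back to w. *)
Lemma act_ascent w s x : chamber x -> len gP (g s * w)%g = (len gP w).+1 ->
  0 <= act w x 0 s.
Proof.
move=> x0; move e : (len gP w) => N; elim/ltn_ind: N w s e => N IH w s e sw.
have [w1|/(len_descent_ex gP) [t tw]] := pselect (w = 1%g).
  by rewrite w1 act1.
have ts : t != s by apply/eqP => ts; move: sw tw; rewrite ts; lia.
have st : s != t by rewrite eq_sym.
have [k [v [wv kv vs]]] := alt_strip s t w.
have k0 : (0 < k)%N.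
  rewrite lt0n; apply/eqP => k0; move: vs wv kv; rewrite k0 /= mul1g => vs wv _.
  by move: tw; rewrite wv; lia.
(* This letter is the last one of [alt t s k]: if it were a descent of v, absorbing it into v would
   make w shorter than it is. *)
have vs' : len gP (g (if odd k then t else s) * v)%g = (len gP v).+1.
  have [//|] := len_ascent_or_descent gP (if odd k then t else s) v => vd.
  case: k k0 wv kv {vs} vd => // k _ wv kv vd.
  have := len_alt_mul t s k (g (if odd k.+1 then t else s) * v)%g.
  suff -> : (alt t s k * (g (if odd k.+1 then t else s) * v))%g = w by lia.
  rewrite wv -[in RHS]addn1 alt_cat -mulgA /= if_neg.
  by case: (odd k); rewrite /= mulg1.
have vpos u : u = s \/ u = t -> 0 <= act v x 0 u.
  move=> uE; apply: (IH (len gP v)) => //; first by lia.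
  by case: uE vs vs' => ->; case: (odd k).
rewrite wv actM; apply: alt_coord_ge0 => //; [by apply: vpos; left|by apply: vpos; right|].
(* If k >= m, the braid relation rewrites the first m letters so that they start with s, which makes
   s a descent of w. *)
have [//|m0 /=] := eqVneq (m s t) 0%N; rewrite ltnNge; apply/negP => mk.
have : (len gP (g s * w) < len gP w)%N; last by lia.
have := alt_braid s t; case em : (m s t) m0 mk => [//|M] _ Mk ab.
have -> : (g s * w = alt t s M * ((if odd M.+1 then alt s t (k - M.+1)
    else alt t s (k - M.+1)) * v))%g.
  by rewrite wv -{1}(subnKC Mk) alt_cat -ab /= -!mulgA (gen_mulK gP).
move: (len_alt_mul s t (k - M.+1) v) (len_alt_mul t s (k - M.+1) v).
set u := if _ then _ else _ => ust uts.
have : (len gP (u * v) <= k - M.+1 + len gP v)%N by rewrite /u; case: ifP.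
by have := len_alt_mul t s M (u * v)%g; lia.
Qed.

Lemma act_descent w s x : chamber x -> len gP w = (len gP (g s * w)%g).+1 ->
  act w x 0 s <= 0.
Proof.
move=> x0 e; have := @act_ascent (g s * w)%g s x x0.
by rewrite (gen_mulK gP) => /(_ e); rewrite actM act_gen_diag oppr_ge0.
Qed.

Lemma act_lt0_descent w s x : chamber x -> act w x 0 s < 0 ->
  len gP w = (len gP (g s * w)%g).+1.
Proof.
move=> x0 ws; have [|//] := len_ascent_or_descent gP s w.
by move=> /(act_ascent x0); rewrite leNgt ws.
Qed.

(* The closed chamber is a strict fundamental domain; that w lies in the standard
   parabolic subgroup fixing x is expressed by the induction principle P of that
   subgroup. *)
Lemma act_chamber w x (P : W -> Prop) : chamber x -> chamber (act w x) ->
  P 1%g -> (forall s u, x 0 s = 0 -> P u -> P (g s * u)%g) ->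
  act w x = x /\ P w.
Proof.
move=> x0 wx P1 PM; move e : (len gP w) => N; elim: N w e wx => [|N IH] w e wx.
  by rewrite (len0 e) act1.
have [|s sw] := len_descent_ex gP (w := w).
  by move=> w1; move: e; rewrite w1 len1.
have ws : act w x 0 s = 0.
  by apply/eqP; rewrite eq_le wx andbT; exact: act_descent.
have swx : act (g s * w)%g x = act w x by rewrite actM act_gen_fix.
have [||swx' Psw] := IH (g s * w)%g; [by lia|by rewrite swx|].
split; first by rewrite -swx.
by rewrite -(gen_mulK gP s w); apply: PM => //; rewrite -swx' swx.
Qed.

Lemma act_interior_inj w x : (forall s, 0 < x 0 s) -> act w x = x -> w = 1%g.
Proof.
move=> x0 wx; have xC : chamber x by move=> s; exact: ltW.
have [||||//] := @act_chamber w x (fun w => w = 1%g) => //; first by rewrite wx.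
by move=> s u xs; have := x0 s; rewrite xs ltxx.
Qed.

Lemma act_ascent_gt0 w s x : (forall s, 0 < x 0 s) ->
  len gP (g s * w)%g = (len gP w).+1 -> 0 < act w x 0 s.
Proof.
move=> x0 e; have xC : chamber x by move=> t; exact: ltW.
rewrite lt_neqAle act_ascent// andbT; apply/eqP => /esym ws0.
have : act (w^-1 * (g s * w))%g x = x by rewrite !actM act_gen_fix// actK.
move=> /act_interior_inj -/(_ x0)/(congr1 (fun u => w * u)%g).
by rewrite mulVKg mulg1 => e'; move: e; rewrite e'; lia.
Qed.

(* Convexity of the Tits cone, with control of the chambers met by a segment. *)
Lemma segment_chambers x y w (a b : R) : chamber x -> chamber y -> 0 <= a -> 0 <= b ->
  exists u, (len gP u <= len gP w)%N /\
    chamber (act u^-1%g (a *: x + b *: act w y)).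
Proof.
move=> + y0 + +; move e : (len gP w) => N.
elim/ltn_ind: N w e x a b => N IH w e x a b x0 a0 b0.
have [zC|nzC] := pselect (chamber (a *: x + b *: act w y)).
  by exists 1%g; rewrite invg1 act1 len1.
have [s0 zs0] : exists s, (a *: x + b *: act w y) 0 s < 0.
  apply: contrapT => ns; apply: nzC => s; rewrite leNgt; apply/negP => zs.
  by apply: ns; exists s.
move: zs0; rewrite !mxE => zs0.
have ys0 : act w y 0 s0 < 0.
  rewrite ltNge; apply/negP => ys0; move: zs0.
  by rewrite ltNge addr_ge0// mulr_ge0.
(* The coefficient of w y at which the path starting at a x meets the wall of s; the smallest value
   is where the path leaves the chamber. *)
pose f s := a * x 0 s / - act w y 0 s.
have [s ys smin] := @arg_minP _ _ _ s0 (fun s => act w y 0 s < 0) f ys0.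
have f0 : 0 <= f s by rewrite divr_ge0 ?mulr_ge0// oppr_ge0 ltW.
have fb : f s <= b.
  apply: le_trans (smin _ ys0) _; rewrite ler_pdivrMr ?oppr_gt0//.
  by rewrite mulrN lerNr -subr_ge0; lra.
pose x' := a *: x + f s *: act w y.
have x's : x' 0 s = 0 by rewrite !mxE /f; field; rewrite lt_eqF.
have x'C : chamber x'.
  move=> t; rewrite !mxE; have [yt|yt] := leP 0 (act w y 0 t).
    by rewrite addr_ge0// mulr_ge0.
  have := smin _ yt; rewrite {2}/f ler_pdivlMr ?oppr_gt0//; lra.
have sw := act_lt0_descent y0 ys.
(* The exit point x' is fixed by s. Reflecting the rest of the path in s makes it start at x' again,
   with the shorter element s w in place of w. *)
have [|||u [uN uC]] := IH (len gP (g s * w)%g) _ (g s * w)%g erefl x' 1 (b - f s) x'C.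
- by lia.
- by rewrite ler01.
- by rewrite subr_ge0.
exists (g s * u)%g; split; first by have := len_gen_mul gP s u; lia.
rewrite invgM actM (genV gP).
have -> : a *: x + b *: act w y = 1 *: x' + (b - f s) *: act w y.
  by rewrite scale1r /x' scalerBl -addrA [f s *: _ + _]addrC subrK.
by rewrite actD !actZ -actM act_gen_fix.
Qed.

(** Such a w is a longest element: len (u w) + len u = len w for every u. When s u is longer than u,
    u x0 is positive at s, so u w x is negative there and s is a descent of u w. *)
Lemma finite_of_opposite x0 x w : (forall s, 0 < x0 0 s) -> chamber x ->
  act w x = - x0 -> finite_set [set: W].
Proof.
move=> x00 xC wx.
suff h u : (len gP (u * w)%g + len gP u = len gP w)%N.
  apply: sub_finite_set (finite_len_le gP (len gP w)) => u _ /=.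
  by rewrite -(h u) leq_addl.
move e : (len gP u) => N; elim: N u e => [|N IH] u e.
  by rewrite (len0 e) mul1g addn0.
have [|s su] := len_descent_ex gP (w := u).
  by move=> u1; move: e; rewrite u1 len1.
have := IH (g s * u)%g; rewrite -mulgA => /(_ ltac:(lia)) e1.
have : 0 < act (g s * u)%g x0 0 s.
  by apply: act_ascent_gt0 => //; rewrite (gen_mulK gP).
have -> : x0 = - act w x by rewrite wx opprK.
rewrite actN mxE oppr_gt0 -actM -mulgA => /(act_lt0_descent xC).
by rewrite (gen_mulK gP) -e1 => ->; rewrite addSnnS.
Qed.

Let ones : V := const_mx 1.

Lemma tits_cone_full : finite_set [set: W] ->
  forall y, exists w, chamber (act w^-1%g y).
Proof.
move=> finW.
have [w0 w0max] : exists w, forall u, (len gP u <= len gP w)%N.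
  have /finite_seqP[l lE] := finW.
  have [w wl wmax] := @arg_maxnP _ (ord0 : 'I_(size l).+1) predT
    (fun i => len gP (nth 1%g l i)) isT.
  exists (nth 1%g l w) => u; have : [set: W] u by [].
  rewrite lE /= => ul; have iu : (index u l < (size l).+1)%N by rewrite ltnS index_size.
  by have := wmax (Ordinal iu) isT; rewrite /= nth_index.
have ones_gt0 s : 0 < ones 0 s by rewrite mxE.
have w0neg s : act w0 ones 0 s < 0.
  have := @act_ascent_gt0 (g s * w0)%g s ones ones_gt0; rewrite (gen_mulK gP).
  have [e|e] := len_ascent_or_descent gP s w0.
    by have := w0max (g s * w0)%g; rewrite e ltnn.
  by move=> /(_ e); rewrite actM act_gen_diag oppr_gt0.
move=> y.
have [M M0 MC] : exists2 M, 0 <= M & chamber (y - M *: act w0 ones).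
  (* Since w0 sends [ones] into the open negative chamber, subtracting this large a multiple makes
     all coordinates of y non-negative. Then y lies on a sum of a chamber vector and a translate of
     one, and convexity applies. *)
  exists (\sum_s `|y 0 s| / - act w0 ones 0 s).
    by apply: sumr_ge0 => s _; rewrite divr_ge0// oppr_ge0 ltW.
  move=> s; rewrite !mxE -mulrN (bigD1 s)//= mulrDl divfK; last first.
    by rewrite oppr_eq0 lt_eqF.
  have := ler_norm (- y 0 s); rewrite normrN.
  set A := _ * _; have : 0 <= A; last by lra.
  rewrite mulr_ge0//; last by rewrite oppr_ge0 ltW.
  by apply: sumr_ge0 => t _; rewrite divr_ge0// oppr_ge0 ltW.
have onesC : chamber ones by move=> s; exact: ltW.
have [u [_ uC]] := segment_chambers w0 MC onesC ler01 M0.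
by exists u; move: uC; rewrite scale1r subrK.
Qed.

End TitsRepresentation.

(** * Singular cohomology *)

Section CohomologyClass.
Local Open Scope quotient_scope.
Variables (R : realType) (X : topologicalType) (n : nat).
Implicit Types b c : cocycle R X n.

Definition cohomology_class c : cohomology R X n := \pi_(cohomology R X n) c.

Definition cohomology_repr (q : cohomology R X n) : cocycle R X n := repr q.

Lemma cohomology_reprK : cancel cohomology_repr cohomology_class.
Proof. by move=> q; exact: reprK. Qed.

Lemma cohomology_classP b c :
  cohomology_class b = cohomology_class c <-> is_coboundary (val b - val c).
Proof.
rewrite -raddfB; split => [/eqP|bc].
  by rewrite -Quotient.idealrBE => /asboolP.
by apply/eqP; rewrite -Quotient.idealrBE; apply/asboolP.
Qed.

Lemma cohomology_classB b c :
  cohomology_class (b - c) = cohomology_class b - cohomology_class c.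
Proof. exact: raddfB. Qed.

End CohomologyClass.

Section CohomologyMap.
Variables (R : realType) (X Y : topologicalType) (f : continuousType X Y).

Definition comp_simplex n (s : singular_simplex R X n) : singular_simplex R Y n :=
  [the continuousType _ _ of f \o s].

Definition pullback n (c : cochain R Y n) : cochain R X n :=
  fun s => c (comp_simplex s).

Lemma coboundary_pullback n (c : cochain R Y n) :
  coboundary (pullback c) = pullback (coboundary c).
Proof.
apply/funext => s; apply: eq_bigr => i _; congr (_ * c _).
exact/continuousEP.
Qed.

Lemma is_coboundary_pullback n (c : cochain R Y n) :
  is_coboundary c -> is_coboundary (pullback c).
Proof.
case: n c => [|n] c /=; first by move=> ->.
by move=> [b ->]; exists (pullback b); rewrite coboundary_pullback.
Qed.

Lemma is_cocycle_pullback n (c : cocycle R Y n) :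
  pullback (val c) \in @is_cocycle R X n.
Proof.
by apply/asboolP; rewrite coboundary_pullback; case: c => c /= /asboolP ->.
Qed.

Definition cocycle_map n (c : cocycle R Y n) : cocycle R X n :=
  Sub (pullback (val c)) (is_cocycle_pullback c).

Definition cohomology_map n (q : cohomology R Y n) : cohomology R X n :=
  cohomology_class (cocycle_map (cohomology_repr q)).

Lemma cohomology_map_class n (c : cocycle R Y n) :
  cohomology_map (cohomology_class c) = cohomology_class (cocycle_map c).
Proof.
have := @is_coboundary_pullback n
  (val (cohomology_repr (cohomology_class c)) - val c).
move=> h; apply: (cohomology_classP _ _).2; apply: h.
by apply: (cohomology_classP _ _).1; rewrite cohomology_reprK.
Qed.

Lemma cohomology_map_additive n : zmod_morphism (@cohomology_map n).
Proof.
move=> a b; rewrite -[a]cohomology_reprK -[b]cohomology_reprK -cohomology_classB.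
rewrite !cohomology_map_class -cohomology_classB.
by congr cohomology_class; apply: val_inj; rewrite [RHS]raddfB.
Qed.

HB.instance Definition _ n := GRing.isZmodMorphism.Build _ _
  (@cohomology_map n) (@cohomology_map_additive n).

End CohomologyMap.

Lemma same_cohomology_of_maps (R : realType) (X Y : topologicalType)
    (f : continuousType X Y) (g : continuousType Y X) :
  (forall n (c : cocycle R X n),
     is_coboundary (pullback f (pullback g (val c)) - val c)) ->
  (forall n (c : cocycle R Y n),
     is_coboundary (pullback g (pullback f (val c)) - val c)) ->
  same_cohomology R X Y.
Proof.
move=> fg gf n; exists (@cohomology_map R Y X g n).
exists (@cohomology_map R X Y f n) => q; rewrite -[q]cohomology_reprK.
  rewrite -[LHS]/(cohomology_map f (cohomology_map g
    (cohomology_class (cohomology_repr q)))) !cohomology_map_class.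
  by apply: (cohomology_classP _ _).2; exact: (fg n (cohomology_repr q)).
rewrite -[LHS]/(cohomology_map g (cohomology_map f
  (cohomology_class (cohomology_repr q)))) !cohomology_map_class.
by apply: (cohomology_classP _ _).2; exact: (gf n (cohomology_repr q)).
Qed.

Lemma comp_simplexK (R : realType) (X Y : topologicalType)
    (f : continuousType X Y) (g : continuousType Y X) n :
  cancel f g -> cancel (@comp_simplex R X Y f n) (@comp_simplex R Y X g n).
Proof. by move=> fK s; apply/continuousEP => a; exact: fK. Qed.

Lemma is_coboundary0 (R : realType) (X : topologicalType) n :
  is_coboundary (0 : cochain R X n).
Proof. by case: n => [|n] //=; exists 0; rewrite coboundary0. Qed.

Lemma same_cohomology_homeomorphism (R : realType) (X Y : topologicalType)
    (f : X -> Y) (g : Y -> X) :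
  continuous f -> continuous g -> cancel f g -> cancel g f ->
  same_cohomology R X Y.
Proof.
move=> fc gc fK gK.
apply: (@same_cohomology_of_maps R X Y (mkcts fc) (mkcts gc)) => n c.
  suff -> : pullback (mkcts fc) (pullback (mkcts gc) (val c)) = val c.
    by rewrite subrr; exact: is_coboundary0.
  by apply/funext => s; rewrite /pullback comp_simplexK.
suff -> : pullback (mkcts gc) (pullback (mkcts fc) (val c)) = val c.
  by rewrite subrr; exact: is_coboundary0.
by apply/funext => s; rewrite /pullback comp_simplexK.
Qed.

Lemma rV_continuous (R : realType) (T : topologicalType) n
    (f : T -> 'rV[R]_n.+1) :
  (forall j, continuous (fun t => f t 0 j)) -> continuous f.
Proof.
move=> fc x B [C nC CB]; have FF := @nbhs_filter _ x.
have H i j : \forall y \near x, C i j (f y i j).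
  by rewrite (ord1 i); apply: fc; have := nC 0 j.
have := @filter_forall _ _ _ _ FF (fun i => @filter_forall _ _ _ _ FF (H i)).
by move=> h; apply: (@filterS _ _ _ _ _ _ h) => y; exact: CB.
Qed.

Lemma set_type_continuous (T U : topologicalType) (A : set U) (f : T -> A) :
  continuous (fun t => set_val (f t)) -> continuous f.
Proof. exact: continuous_comp_initial. Qed.

Lemma set_val_continuous (U : topologicalType) (A : set U) :
  continuous (set_val : A -> U).
Proof. exact: initial_continuous. Qed.

Section RealContinuity.
Variables (R : realType) (T : topologicalType).
Implicit Types f g : T -> R.

Lemma cts_add f g : continuous f -> continuous g -> continuous (fun t => f t + g t).
Proof. by move=> fc gc t; apply: cvgD; [exact: fc|exact: gc]. Qed.

Lemma cts_sub f g : continuous f -> continuous g -> continuous (fun t => f t - g t).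
Proof. by move=> fc gc t; apply: cvgB; [exact: fc|exact: gc]. Qed.

Lemma cts_mul f g : continuous f -> continuous g -> continuous (fun t => f t * g t).
Proof. by move=> fc gc t; apply: cvgM; [exact: fc|exact: gc]. Qed.

Lemma cts_div f g : continuous f -> continuous g -> (forall t, g t != 0) ->
  continuous (fun t => f t / g t).
Proof.
by move=> fc gc g0 t; apply: cvgM; [exact: fc|apply: cvgV (g0 t) _; exact: gc].
Qed.

Lemma cts_sum (I : Type) (r : seq I) (F : I -> T -> R) :
  (forall i, continuous (F i)) -> continuous (fun t => \sum_(i <- r) F i t).
Proof.
move=> Fc; elim: r => [|i r IH].
  by under eq_fun do rewrite big_nil; exact: cst_continuous.
by under eq_fun do rewrite big_cons; exact: cts_add.
Qed.

Lemma cts_norm f : continuous f -> continuous (fun t => `|f t|).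
Proof. by move=> fc t; apply: cvg_norm; exact: fc. Qed.

Lemma cts_coord n (f : T -> 'rV[R]_n) j : continuous f -> continuous (fun t => f t 0 j).
Proof.
move=> fc t; apply: (@continuous_comp _ _ _ f (fun x : 'rV[R]_n => x 0 j)).
  exact: fc.
exact: coord_continuous.
Qed.

End RealContinuity.

(** * Cones over singular simplices *)

Section Cone.
Variables (R : realType) (X : topologicalType) (H : X -> R -> X) (x0 : X).
Hypothesis H0 : forall x, H x 0 = x.
Hypothesis H1 : forall x, H x 1 = x0.
(** Continuity is required only along singular simplices: by compactness each of them meets finitely
    many chambers, where the contraction can be controlled. *)
Hypothesis H_continuous : forall n (s : @std_simplex R n -> X)
    (l : @std_simplex R n -> R),
  continuous s -> continuous l -> (forall a, 0 <= l a <= 1) ->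
  continuous (fun a => H (s a) (l a)).

Let apex n (a : @std_simplex R n.+1) : R := set_val a 0 0.

(** The cone uses [2 * height] as homotopy time. The cap at 1/2 keeps the denominator 1 - height
    away from 0. *)
Let height n (a : @std_simplex R n.+1) : R := Num.min (apex a) (1/2).

(* Projects the simplex from its vertex 0 to the opposite face; beyond height 1/2,
   where the cone is constant, the missing mass is put on vertex 0 to keep the
   projection continuous at the apex. *)
Let base_fun n (a : @std_simplex R n.+1) : 'rV[R]_n.+1 :=
  \row_j ((set_val a 0 (lift ord0 j) + (j == 0)%:R * (apex a - height a)) /
          (1 - height a)).

Let simplexP n (a : @std_simplex R n) :
  (forall i, 0 <= set_val a 0 i) /\ \sum_i set_val a 0 i = 1.
Proof. by have /set_mem := valP a. Qed.

Let height_bounds n (a : @std_simplex R n.+1) :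
  [/\ 0 <= height a, height a <= 1/2 & height a <= apex a].
Proof.
have [a0 _] := simplexP a; have := a0 0; rewrite -/(apex a) /height => h.
by split; [rewrite le_min h /=; lra|rewrite ge_min lexx orbT|rewrite ge_min lexx].
Qed.

Let base_simplex n (a : @std_simplex R n.+1) : base_fun a \in @std_simplex R n.
Proof.
have [a0 a1] := simplexP a; have [h0 h1 h2] := height_bounds a.
have h3 : 0 < 1 - height a by lra.
apply/mem_set; split=> [j|].
  rewrite mxE divr_ge0 ?(ltW h3)// addr_ge0 ?a0//.
  by rewrite mulr_ge0 ?ler0n// subr_ge0.
under eq_bigr do rewrite mxE.
rewrite -mulr_suml big_split /= [X in _ + X](bigD1 (0 : 'I_n.+1))//= mul1r.
rewrite [X in _ + (_ + X)]big1 ?addr0 => [|i /negbTE ->]; last by rewrite mul0r.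
move: a1; rewrite big_ord_recl -/(apex a) => a1.
have -> : \sum_(i < n.+1) set_val a 0 (lift ord0 i) = 1 - apex a.
  by rewrite -a1 addrC addKr.
by rewrite addrA subrK divff// gt_eqF.
Qed.

Let base n (a : @std_simplex R n.+1) : @std_simplex R n := SigSub (base_simplex a).

Let apex_continuous n : continuous (@apex n).
Proof. exact/cts_coord/set_val_continuous. Qed.

Let height_continuous n : continuous (@height n).
Proof.
by move=> a; apply: continuous_min; [exact: apex_continuous|exact: cst_continuous].
Qed.

Let base_continuous n : continuous (@base n).
Proof.
apply: set_type_continuous; apply: rV_continuous => j.
under eq_fun do rewrite set_valE /= mxE.
apply: cts_div => [||a].
- apply: cts_add; first exact/cts_coord/set_val_continuous.
  apply: cts_mul; first exact: cst_continuous.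
  by apply: cts_sub; [exact: apex_continuous|exact: height_continuous].
- by apply: cts_sub; [exact: cst_continuous|exact: height_continuous].
- by have [_ h1 _] := height_bounds a; rewrite gt_eqF//; lra.
Qed.

Let cone_fun n (s : singular_simplex R X n) (a : @std_simplex R n.+1) : X :=
  H (s (base a)) (2 * height a).

Let cone_continuous n (s : singular_simplex R X n) : continuous (cone_fun s).
Proof.
apply: H_continuous => [a||a].
- by apply: continuous_comp; [exact: base_continuous|exact: cts_fun].
- by apply: cts_mul; [exact: cst_continuous|exact: height_continuous].
- by have [h0 h1 _] := height_bounds a; apply/andP; split; lra.
Qed.

Definition cone n (s : singular_simplex R X n) : singular_simplex R X n.+1 :=
  [the continuousType _ _ of mkcts (@cone_continuous n s)].

Let face_val n (i : 'I_n.+2) (a : @std_simplex R n) j :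
  set_val (face_map i a) 0 j = if unlift i j is Some k then set_val a 0 k else 0.
Proof. by rewrite [LHS]mxE. Qed.

Lemma cone_face0 n (s : singular_simplex R X n) :
  [the continuousType _ _ of cone s \o @face_map R n ord0] = s.
Proof.
apply/continuousEP => a.
rewrite -[LHS]/(H (s (base (face_map ord0 a))) (2 * height (face_map ord0 a))).
have a0 : apex (face_map ord0 a) = 0 by rewrite /apex face_val unlift_none.
have h0 : height (face_map ord0 a) = 0 by rewrite /height a0 min_l//; lra.
rewrite h0 mulr0 H0; congr (s _); apply: val_inj; apply/rowP => j /=.
by rewrite mxE face_val liftK a0 h0 !subr0 mulr0 addr0 divr1.
Qed.

Let unlift_lift0 n (i : 'I_n.+2) (j : 'I_n.+2) :
  unlift (lift ord0 i) (lift ord0 j) = omap (lift ord0) (unlift i j).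
Proof.
case: (unliftP i j) => [k ->|->] /=; last by rewrite unlift_none.
have -> : lift ord0 (lift i k) = lift (lift ord0 i) (lift ord0 k).
  by apply: val_inj; rewrite /= /bump /=; lia.
by rewrite liftK.
Qed.

Let face_apex n (i : 'I_n.+2) (a : @std_simplex R n.+1) :
  apex (face_map (lift ord0 i) a) = apex a.
Proof.
rewrite /apex face_val.
have -> : 0 = lift (lift ord0 i) 0 :> 'I_n.+3 by exact: val_inj.
by rewrite liftK.
Qed.

Lemma cone_face_lift n (s : singular_simplex R X n.+1) (i : 'I_n.+2) :
  [the continuousType _ _ of cone s \o @face_map R n.+1 (lift ord0 i)] =
  cone [the continuousType _ _ of s \o @face_map R n i].
Proof.
apply/continuousEP => a; set fi := face_map (lift ord0 i).
rewrite -[LHS]/(H (s (base (fi a))) (2 * height (fi a))).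
rewrite -[RHS]/(H (s (face_map i (base a))) (2 * height a)) {}/fi.
have hE : height (face_map (lift ord0 i) a) = height a by rewrite /height face_apex.
(* From apex coordinate 1/2 on, both sides equal [x0], so their base points need not agree. Below
   1/2 no mass is moved and the base points coincide. *)
rewrite hE; have [ha|ha] := leP (1/2) (apex a).
  by have -> : 2 * height a = 1; rewrite ?H1// /height min_r//; lra.
have {}ha : height a = apex a by rewrite /height min_l// ltW.
congr (H (s _) _); apply: val_inj; apply/rowP => j /=.
rewrite -[face_fun i _]/(val (face_map i (base a))) [RHS]face_val mxE hE face_apex ha.
rewrite subrr mulr0 addr0 face_val unlift_lift0; case: unlift => [k|] /=.
  by rewrite mxE ha subrr mulr0 addr0.
by rewrite mul0r.
Qed.

Let cst_simplex : singular_simplex R X 0 := [the continuousType _ _ of cst x0].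

Let cst_map : continuousType X X := [the continuousType X X of cst x0].

Lemma cone_face_apex (s : singular_simplex R X 0) :
  [the continuousType _ _ of cone s \o @face_map R 0 (lift ord0 ord0)] =
  cst_simplex.
Proof.
apply/continuousEP => a; set fi := face_map (lift ord0 ord0).
rewrite -[LHS]/(H (s (base (fi a))) (2 * height (fi a))) {}/fi.
have [_] := simplexP a; rewrite big_ord_recl big_ord0 addr0 => a1.
have -> : 2 * height (face_map (lift ord0 ord0) a) = 1; last by rewrite H1.
rewrite /height /apex face_val.
have -> : 0 = lift (lift ord0 ord0) 0 :> 'I_2 by exact: val_inj.
by rewrite liftK a1 min_r; lra.
Qed.

(** Evaluate the cocycle condition on [cone s]. In degree 0 it says that c takes the same value on s
    and on the constant simplex; in positive degree it exhibits c itself as a coboundary. *)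
Lemma pullback_cst_coboundary n (c : cocycle R X n) :
  is_coboundary (pullback cst_map (val c) - val c).
Proof.
case: n c => [|n] [c /= /asboolP dc].
  apply/funext => s; have := congr1 (fun d => d (cone s)) dc.
  rewrite /coboundary !big_ord_recl big_ord0 cone_face0 cone_face_apex.
  rewrite expr0 expr1 mul1r addr0 mulN1r !fctE => /eqP.
  rewrite subr_eq0 => /eqP cs; apply/eqP; rewrite subr_eq0; apply/eqP.
  by rewrite -[RHS]/(c s) cs; congr (c _); exact/continuousEP.
pose b : cochain R X n := fun s => c (cone s).
have cb : c = coboundary b.
  apply/funext => s; have := congr1 (fun d => d (cone s)) dc.
  rewrite /coboundary big_ord_recl cone_face0 expr0 mul1r.
  rewrite -[X in _ = X]/(0 : int) => /eqP; rewrite addr_eq0 => /eqP ->; rewrite -sumrN.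
  apply: eq_bigr => i _; rewrite cone_face_lift.
  by rewrite /= /bump /= exprS mulN1r mulNr opprK.
exists (pullback cst_map b - b).
by rewrite coboundaryB coboundary_pullback -cb.
Qed.

Lemma same_cohomology_point : same_cohomology R X (point_space R).
Proof.
have pt0 : (0 : R) \in point_space R by rewrite inE.
have ptE (p : point_space R) : p = SigSub pt0.
  by apply: val_inj; have /set_mem := valP p.
pose f : continuousType X (point_space R) :=
  [the continuousType _ _ of cst (SigSub pt0 : point_space R)].
pose h : continuousType (point_space R) X := [the continuousType _ _ of cst x0].
apply: (@same_cohomology_of_maps R X (point_space R) f h) => n c.
  have -> : pullback f (pullback h (val c)) =
      pullback cst_map (val c).
    by apply/funext => s; congr (val c _); exact/continuousEP.
  exact: pullback_cst_coboundary.
suff -> : pullback h (pullback f (val c)) = val c.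
  by rewrite subrr; exact: is_coboundary0.
apply/funext => s; congr (val c _); apply/continuousEP => a.
by rewrite [RHS]ptE.
Qed.

End Cone.

(** * Vertices of the Coxeter complex *)

Lemma fproperP (T : choiceType) (A B : {fset T}) :
  (A `<` B)%fset <-> {subset A <= B} /\ exists2 x, x \in B & x \notin A.
Proof.
rewrite fproperE; split=> [/andP[/fsubsetP AB /fsubsetPn[x xB xA]]|[AB [x xB xA]]].
  by split=> //; exists x.
by apply/andP; split; [apply/fsubsetP|apply/fsubsetPn; exists x].
Qed.

Section CoxeterVertices.
Variables (W : groupType) (S : {fset W}).

Lemma parabolic_subgroup (I : {fset W}) : is_subgroup (parabolic I).
Proof.
split=> [H [[H1 _] _] //|x y Hx Hy H HP].
by have [[_ HM] _] := HP; apply: HM; [exact: Hx|exact: Hy].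
Qed.

Lemma parabolic_gen (I : {fset W}) x : x \in I -> parabolic I x.
Proof. by move=> xI H [_ IH]; exact: IH. Qed.

Lemma parabolic_min (I : {fset W}) (H : set W) :
  is_subgroup H -> [set` I] `<=` H -> parabolic I `<=` H.
Proof. by move=> HS IH x /(_ H); apply. Qed.

Lemma parabolic_sub (I J : {fset W}) : (I `<=` J)%fset -> parabolic I `<=` parabolic J.
Proof.
move=> /fsubsetP IJ; apply: parabolic_min; first exact: parabolic_subgroup.
by move=> x /IJ; exact: parabolic_gen.
Qed.

Section Subgroup.
Variable H : set W.
Hypothesis HS : is_subgroup H.

Lemma subgroupV x : H x -> H x^-1%g.
Proof. by have [H1 HM] := HS => Hx; rewrite -[_^-1%g]mul1g; exact: HM. Qed.

Lemma subgroupM x y : H x -> H y -> H (x * y)%g.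
Proof.
by have [_ HM] := HS => Hx Hy; rewrite -[y]invgK; apply: HM => //; exact: subgroupV.
Qed.

Lemma left_cosetP w x : left_coset w H x <-> H (w^-1 * x)%g.
Proof.
split=> [[y Hy <-]|Hx]; first by rewrite mulKg.
by exists (w^-1 * x)%g => //; rewrite mulVKg.
Qed.

Lemma left_coset_eqP w u : left_coset w H = left_coset u H <-> H (w^-1 * u)%g.
Proof.
split=> [e|Hwu].
  by apply/left_cosetP; rewrite e; apply/left_cosetP; rewrite mulVg; case: HS.
apply/seteqP; split=> x /left_cosetP Hx; apply/left_cosetP.
  have -> : (u^-1 * x = (w^-1 * u)^-1 * (w^-1 * x))%g.
    by rewrite invgM invgK -mulgA mulVKg.
  by apply: subgroupM => //; exact: subgroupV.
have -> : (w^-1 * x = (w^-1 * u) * (u^-1 * x))%g by rewrite -mulgA mulVKg.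
exact: subgroupM.
Qed.

End Subgroup.

Variables (n : nat) (g : 'I_n.+1 -> W) (m : 'I_n.+1 -> 'I_n.+1 -> nat).
Hypothesis gP : indexed_coxeter_system g m.
Hypothesis gS : forall x, (x \in S) <-> exists s, g s = x.
Variable R : realType.

Notation V := 'rV[R]_n.+1.
Notation act := (@act R W n g m gP).
Implicit Types (s t : 'I_n.+1) (w u : W).

Let one_neqN1 : (1 : R) <> -1. Proof. by move=> e; lra. Qed.

(** The representation separates generators: s negates coordinate s of the basis vector e_s, and any
    other generator fixes e_s. *)
Lemma gen_inj : injective g.
Proof.
move=> s t e; apply: contrapT => /eqP st.
have := @act_gen_diag R _ _ _ _ gP s (delta_mx 0 s).
rewrite e act_gen_fix ?mxE ?eqxx; last by rewrite eq_sym (negbTE st).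
by rewrite ?mxE ?eqxx => /one_neqN1.
Qed.

Definition maxpar s : set W := parabolic (S `\ g s)%fset.

Lemma maxpar_subgroup s : is_subgroup (maxpar s).
Proof. exact: parabolic_subgroup. Qed.

Lemma maxpar1 s : maxpar s 1%g. Proof. by have [] := maxpar_subgroup s. Qed.

Lemma maxpar_gen s t : t != s -> maxpar s (g t).
Proof.
move=> ts; apply: parabolic_gen; rewrite !inE (inj_eq gen_inj) ts /=.
by apply/gS; exists t.
Qed.

Lemma maxpar_fix s w : maxpar s w -> act w (delta_mx 0 s) = delta_mx 0 s.
Proof.
pose H : set W := [set w | act w (delta_mx 0 s) = delta_mx 0 s :> V].
apply: (@parabolic_min _ H) => [|x]; rewrite /H /=.
  split=> /= [|x y ex ey]; first exact: act1.
  by rewrite actM -{1}ey actK.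
rewrite !inE => /andP[xs /gS[t tx]]; rewrite -tx act_gen_fix//.
by rewrite mxE eqxx /= -(inj_eq gen_inj) tx (negbTE xs).
Qed.

Lemma maxpar_genN s : ~ maxpar s (g s).
Proof.
move=> /maxpar_fix e; have := act_gen_diag gP s (delta_mx 0 s : V).
by rewrite e mxE !eqxx => /one_neqN1.
Qed.

Definition vertex w s : set W := left_coset w (maxpar s).

Lemma vertex_eqP w u s : vertex w s = vertex u s <-> maxpar s (w^-1 * u)%g.
Proof. exact/left_coset_eqP/maxpar_subgroup. Qed.

(** If s and t differed, the coset u W_(S \ s) would contain u t, whereas t is not in W_(S \ t). *)
Lemma vertex_type w u s t : vertex w s = vertex u t -> s = t.
Proof.
move=> e; apply: contrapT => /eqP st.
have wu : maxpar s (w^-1 * u)%g.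
  apply/left_cosetP; rewrite -/(vertex w s) e; apply/left_cosetP.
  by rewrite mulVg; exact: maxpar1.
have : vertex u t (u * g t)%g.
  rewrite -e (iffRL (vertex_eqP w u s) wu); apply/left_cosetP; rewrite mulKg.
  by apply: maxpar_gen; rewrite eq_sym.
by move=> /left_cosetP; rewrite mulKg; exact: maxpar_genN.
Qed.

Lemma vertex_inj w : injective (vertex w).
Proof. by move=> s t; exact: vertex_type. Qed.

Lemma vertex_dim0 v : coxeter_simplex_of_dim S 0 v <-> exists w s, v = vertex w s.
Proof.
split=> [[w [I [IS dI ->]]]|[w [s ->]]].
  have /fproperP[sIS [x xS xI]] := IS.
  have [s gx] := iffLR (gS x) xS.
  exists w, s; congr (left_coset w (parabolic _)).
  have sub : (I `<=` S `\ g s)%fset.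
    apply/fsubsetP => y yI; rewrite !inE sIS// andbT.
    by apply/eqP => yx; move: xI; rewrite -gx -yx yI.
  apply/eqP; rewrite eqEfcard sub /=.
  (* With truncated subtraction, dimension 0 only says that S has at most one element more than I;
     the inclusion [sub] then gives equality. *)
  move/eqP: dI; rewrite subn_eq0 leq_subLR => dI.
  by have := cardfsD1 (g s) S; rewrite gx xS -(leq_add2l 1) => <-; rewrite addnC.
exists w, (S `\ g s)%fset; have sS : g s \in S by apply/gS; exists s.
split=> //; first exact: fproperD1.
by rewrite (cardfsD1 (g s) S) sS addnK.
Qed.

(** A vertex containing the coset contains w, hence is some w W_(S \ s). If s were in I it would
    also contain w s, which it does not. *)
Lemma vertices_coset w (I : {fset W}) : (I `<` S)%fset ->
  coxeter_vertices S (left_coset w (parabolic I)) =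
  [set vertex w s | s in [set s | g s \notin I]].
Proof.
move=> IS; apply/seteqP; split=> v.
  move=> [/vertex_dim0[u [s ->]] face].
  have uw : vertex w s = vertex u s.
    apply/esym/vertex_eqP/left_cosetP/face/left_cosetP.
    by rewrite mulVg; have [] := parabolic_subgroup I.
  exists s => //=; apply/negP => sI; apply: (@maxpar_genN s).
  rewrite -[g s](mulKg w); apply/left_cosetP; rewrite -/(vertex w s) uw.
  by apply/face/left_cosetP; rewrite mulKg; exact: parabolic_gen.
move=> [s /= sI <-]; split; first by apply/vertex_dim0; exists w, s.
move=> x /left_cosetP Ix; apply/left_cosetP; apply: parabolic_sub Ix.
apply/fsubsetP => y yI; rewrite !inE; apply/andP; split.
  by apply/eqP => ys; move: sI; rewrite -ys yI.
by have /fproperP[sIS _] := IS; exact: sIS.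
Qed.

Lemma coxeter_complexP (s : set (set W)) :
  coxeter_complex S s <->
  exists w (J : set 'I_n.+1), J !=set0 /\ s = [set vertex w t | t in J].
Proof.
split=> [[_ [d [w [I [IS _ ->]]]] <-]|[w [J [[t Jt] ->]]]].
  exists w, [set s | g s \notin I]; split; last exact: vertices_coset.
  have /fproperP[_ [x /gS[t <-] xI]] := IS; by exists t.
(* The generators whose index is outside J; this subset is proper because J is non-empty. *)
pose I := [fset x in S | `[< forall t, J t -> g t <> x >]]%fset.
have IS : (I `<` S)%fset.
  apply/fproperP; split.
    by move=> x; rewrite !inE => /andP[].
  exists (g t); first by apply/gS; exists t.
  by rewrite !inE negb_and; apply/orP; right; apply/asboolPn => /(_ t Jt).
exists (left_coset w (parabolic I)).
  by exists (#|` S| - #|` I| - 1)%N, w, I.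
rewrite vertices_coset//; congr (_ @` _); apply/seteqP; split=> r /=.
  rewrite !inE negb_and; have -> : g r \in S by apply/gS; exists r.
  move=> /= /asboolPn h; apply: contrapT => Jr; apply: h => q Jq /gen_inj qr.
  by apply: Jr; rewrite -qr.
move=> Jr; rewrite !inE negb_and; apply/orP; right.
by apply/asboolPn => /(_ r Jr).
Qed.

End CoxeterVertices.

(** * The realization and the Tits cone *)

Lemma realization_ext (R : realType) (V : choiceType) (K : set (set V))
  (p q : realization R K) : weight p = weight q -> p = q.
Proof.
case: p q => [p p0 pK p1] [q q0 qK q1] /= pq; subst q.
by congr Realization; exact: Prop_irrelevance.
Qed.

Section TitsConeMaps.
Variables (R : realType) (W : groupType) (S : {fset W}) (n : nat).
Variables (g : 'I_n.+1 -> W) (m : 'I_n.+1 -> 'I_n.+1 -> nat).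
Hypothesis gP : indexed_coxeter_system g m.
Hypothesis gS : forall x, (x \in S) <-> exists s, g s = x.

Notation V := 'rV[R]_n.+1.
Notation act := (@act R W n g m gP).
Notation vertex := (vertex S g).
Notation maxpar := (maxpar S g).
Notation complex := (coxeter_complex S).
Notation X := (realization R complex).
Implicit Types (s t : 'I_n.+1) (w u : W) (x y : V) (p : X).

Let vertex_injw w : injective (vertex w).
Proof. by move=> s t; exact: (vertex_inj gP gS R). Qed.

(** The point p lies in the closed chamber of w; a point on a wall has several frames. *)
Definition framed p w : Prop := forall v, p v != 0 -> exists s, v = vertex w s.

Lemma framed_ex p : exists w, framed p w.
Proof.
have /(coxeter_complexP gP gS R)[w [J [_ e]]] := weight_simplex p.
exists w => v pv; have : weight_support p v by [].
by rewrite e => -[s _ <-]; exists s.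
Qed.

Definition frame p : W := sval (cid (framed_ex p)).

Lemma frameP p : framed p (frame p).
Proof. by rewrite /frame; case: cid. Qed.

Definition coords w p : V := \row_s p (vertex w s).

Definition tits_map p : V := act (frame p) (coords (frame p) p).

Let act_eq_coords w u x : (forall s, x 0 s != 0 -> maxpar s (w^-1 * u)%g) ->
  act w x = act u x.
Proof.
move=> h; have -> : act u x = act w (act (w^-1 * u)%g x) by rewrite -actM mulVKg.
congr (act w _); rewrite {2}[x]row_sum_delta act_sum {1}[x]row_sum_delta.
apply: eq_bigr => s _; rewrite actZ.
have [->|xs] := eqVneq (x 0 s) 0; first by rewrite !scale0r.
by rewrite (maxpar_fix gP gS R (h s xs)).
Qed.

Lemma framed_vertex p w u s : framed p w -> framed p u -> p (vertex w s) != 0 ->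
  vertex w s = vertex u s.
Proof.
move=> pw pu ps; have [t e] := pu _ ps.
by have st := vertex_type gP gS R e; rewrite e st.
Qed.

(** Independence of the frame: if w and u both frame p, then they share the vertices in its support,
    so w^-1 u fixes e_s for each type s that occurs. *)
Lemma tits_mapE p w : framed p w -> tits_map p = act w (coords w p).
Proof.
move=> pw; rewrite /tits_map; have pf := @frameP p.
have -> : coords w p = coords (frame p) p.
  apply/rowP => s; rewrite !mxE.
  have [pws|pws] := eqVneq (p (vertex w s)) 0.
    have [->//|pfs] := eqVneq (p (vertex (frame p) s)) 0.
    by rewrite (framed_vertex pf pw pfs).
  by rewrite (framed_vertex pw pf pws).
apply/esym/act_eq_coords => s; rewrite mxE => ps.
apply/(vertex_eqP S g _ _ _); apply/esym; exact: framed_vertex ps.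
Qed.

Lemma vertex_sum w (f : set W -> R) :
  (forall v, f v != 0 -> exists s, v = vertex w s) ->
  \sum_(v \in [set: set W]) f v = \sum_s f (vertex w s).
Proof.
move=> fw; rewrite (fsbigE [seq vertex w s | s <- enum 'I_n.+1])//=.
- by rewrite big_map; under eq_bigl do rewrite in_setT; rewrite big_enum.
- by rewrite map_inj_uniq ?enum_uniq//; exact: vertex_injw.
- move=> v _ vr; apply/eqP; apply: contraT => /fw[s vs].
  by move: vr; rewrite vs map_f ?mem_enum.
Qed.

Lemma framed_sum p w : framed p w -> \sum_s p (vertex w s) = 1.
Proof. by move=> pw; rewrite -(weight_sum p) (vertex_sum pw). Qed.

(** Barycentric coordinates, in the chamber of w, of the ray through x. Dividing by the l1 norm,
    which is the coordinate sum on the closed chamber, leaves a nonzero denominator for every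
    nonzero x, even outside the chamber. *)
Definition cone_weight w x : set W -> R :=
  fun v => (\sum_s (if `[< v = vertex w s >] then x 0 s else 0)) / \sum_s `|x 0 s|.

Lemma cone_weight_vertex w x s : cone_weight w x (vertex w s) = x 0 s / \sum_t `|x 0 t|.
Proof.
rewrite /cone_weight (bigD1 s)//= big1 ?addr0 => [|t ts].
  by case: asboolP.
by case: asboolP => // /vertex_injw /eqP; rewrite eq_sym (negbTE ts).
Qed.

Lemma cone_weight_out w x v : (forall s, v <> vertex w s) -> cone_weight w x v = 0.
Proof.
move=> vs; rewrite /cone_weight big1 ?mul0r// => s _.
by case: asboolP => // /vs.
Qed.

Lemma norm1_neq0 x : x != 0 -> 0 < \sum_s `|x 0 s|.
Proof.
move=> x0; rewrite lt_neqAle sumr_ge0// andbT eq_sym psumr_neq0//.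
apply/hasP; have [s xs] : exists s, x 0 s != 0.
  apply: contrapT => h; move: x0 => /negP; apply; apply/eqP/rowP => s.
  rewrite mxE; apply/eqP; apply: contrapT => /negP xs; apply: h.
  by exists s.
by exists s; rewrite ?mem_index_enum//= normr_gt0.
Qed.

Lemma cone_weight_framed w x v : cone_weight w x v != 0 -> exists s, v = vertex w s.
Proof.
move=> cv; apply: contrapT => h; move: cv; rewrite cone_weight_out ?eqxx// => s vs.
by apply: h; exists s.
Qed.

Lemma chamber_sum x : chamber x -> \sum_s `|x 0 s| = \sum_s x 0 s.
Proof. by move=> xC; apply: eq_bigr => s _; rewrite ger0_norm. Qed.

Lemma cone_point_ex w x : chamber x -> x != 0 ->
  exists p : X, weight p = cone_weight w x.
Proof.
move=> xC x0; have nx := norm1_neq0 x0.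
have ge0 v : 0 <= cone_weight w x v.
  by rewrite divr_ge0 ?(ltW nx)// sumr_ge0// => s _; case: ifP.
have sum1 : \sum_(v \in [set: set W]) cone_weight w x v = 1.
  rewrite (@vertex_sum w); last exact: cone_weight_framed.
  under eq_bigr do rewrite cone_weight_vertex.
  by rewrite -mulr_suml chamber_sum// divff// -chamber_sum// gt_eqF.
have inK : complex (weight_support (cone_weight w x)).
  apply/(coxeter_complexP gP gS R); exists w, [set s | x 0 s != 0]; split.
    apply: contrapT => h; move: nx; rewrite big1 ?ltxx// => s _.
    apply/eqP; rewrite normr_eq0; apply: contraT => xs.
    by exfalso; apply: h; exists s.
  apply/seteqP; split=> v /=.
    rewrite /weight_support /= => cv; have [s vs] := cone_weight_framed cv.
    exists s => //=; move: cv; rewrite vs cone_weight_vertex.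
    by rewrite mulf_eq0 negb_or => /andP[].
  move=> [s /= xs <-]; rewrite /weight_support /= cone_weight_vertex.
  by rewrite mulf_neq0// invr_eq0 gt_eqF.
by exists (Realization ge0 inK sum1).
Qed.

Definition cone_weight_at w y := cone_weight w (act w^-1%g y).

Definition in_chamber w y := chamber (act w^-1%g y).

Lemma act_neq0 w y : y != 0 -> act w y != 0.
Proof. by apply: contra_neq => /(congr1 (act w^-1%g)); rewrite actK act0. Qed.

(** The strict fundamental domain property, applied to u^-1 w. Its induction principle is used for
    membership in W_(S \ s) for every s where the coordinate of x is nonzero. *)
Lemma in_chamber_unique w u y : in_chamber w y -> in_chamber u y ->
  act w^-1%g y = act u^-1%g y /\
  forall s, act w^-1%g y 0 s != 0 -> vertex w s = vertex u s.
Proof.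
rewrite /in_chamber => wy uy; set x := act w^-1%g y.
have xu : act u^-1%g y = act (u^-1 * w)%g x by rewrite actM /x actKV.
move: uy; rewrite xu => uy.
have [||] := @act_chamber R W n g m gP (u^-1 * w)%g x
  (fun v => forall s, x 0 s != 0 -> maxpar s v) wy uy.
- by move=> s _; exact: maxpar1.
- move=> t v xt h s xs.
  apply: (subgroupM (maxpar_subgroup S g s)); last exact: h.
  by apply: (maxpar_gen gP gS R); apply: contra_eq_neq xt => ->.
move=> -> h; split=> // s xs; apply/esym/(vertex_eqP S g _ _ _).
exact: h.
Qed.

Lemma cone_weight_at_unique w u y : in_chamber w y -> in_chamber u y ->
  cone_weight_at w y = cone_weight_at u y.
Proof.
move=> wy uy; have [e ve] := in_chamber_unique wy uy.
rewrite /cone_weight_at -e; apply/funext => v; congr (_ / _).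
apply: eq_bigr => s _; have [->|xs] := eqVneq (act w^-1%g y 0 s) 0.
  by rewrite !if_same.
by rewrite ve.
Qed.

Lemma ones_neq0 : (const_mx 1 : V) != 0.
Proof.
by apply/eqP => /rowP/(_ 0); rewrite !mxE => /eqP; rewrite oner_eq0.
Qed.

Lemma ones_chamber : chamber (const_mx 1 : V).
Proof. by move=> s; rewrite mxE ler01. Qed.

Let p0 : X := sval (cid (cone_point_ex 1%g ones_chamber ones_neq0)).

(** The default [p0] makes the map total; it is the value off the Tits cone. *)
Definition tits_inv y : X :=
  xget p0 [set p | exists w, in_chamber w y /\ weight p = cone_weight_at w y].

Lemma tits_invE w y : y != 0 -> in_chamber w y ->
  weight (tits_inv y) = cone_weight_at w y.
Proof.
move=> y0 wy; rewrite /tits_inv.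
have [p pw] := cone_point_ex w wy (act_neq0 w^-1%g y0).
case: xgetP => [q _ /= [u [uy ->]]|/(_ p)[]]; first exact: cone_weight_at_unique.
by exists w.
Qed.

Lemma coords_chamber w p : chamber (coords w p).
Proof. by move=> s; rewrite mxE weight_ge0. Qed.

Lemma framed_in_chamber p w : framed p w -> in_chamber w (tits_map p).
Proof. by move=> pw; rewrite /in_chamber (tits_mapE pw) actK; exact: coords_chamber. Qed.

Lemma tits_map_neq0 p : tits_map p != 0.
Proof.
rewrite act_neq0//; apply/eqP => c0; have := framed_sum (@frameP p).
rewrite big1 => [/esym/eqP|s _]; first by rewrite oner_eq0.
by have /rowP/(_ s) := c0; rewrite !mxE.
Qed.

Lemma tits_mapK p : tits_inv (tits_map p) = p.
Proof.
apply: realization_ext; have pw := @frameP p; set w := frame p in pw.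
rewrite (tits_invE (tits_map_neq0 p) (framed_in_chamber pw)).
rewrite /cone_weight_at (tits_mapE pw) actK; apply/funext => v.
have [[s ->]|vs] := pselect (exists s, v = vertex w s).
  rewrite cone_weight_vertex chamber_sum; last exact: coords_chamber.
  under eq_bigr do rewrite mxE.
  by rewrite (framed_sum pw) divr1 mxE.
rewrite cone_weight_out; last by move=> s e; apply: vs; exists s.
by apply/eqP; apply: contrapT => /negP; rewrite eq_sym => /pw.
Qed.

Lemma tits_invK w y : y != 0 -> in_chamber w y ->
  exists2 a, 0 < a & tits_map (tits_inv y) = a *: y.
Proof.
move=> y0 wy; have pE := tits_invE y0 wy.
have pw : framed (tits_inv y) w by move=> v; rewrite pE; exact: cone_weight_framed.
set x := act w^-1%g y.
have nx : 0 < \sum_s `|x 0 s| by apply/norm1_neq0/act_neq0.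
exists (\sum_s `|x 0 s|)^-1; first by rewrite invr_gt0.
rewrite (tits_mapE pw) -{2}[y](actKV gP w) -/x -actZ; congr (act w _).
by apply/rowP => s; rewrite !mxE pE /cone_weight_at cone_weight_vertex mulrC.
Qed.

Lemma tits_invZ w y (a : R) : 0 < a -> y != 0 -> in_chamber w y ->
  tits_inv (a *: y) = tits_inv y.
Proof.
move=> a0 y0 wy; apply: realization_ext.
have ay0 : a *: y != 0 by rewrite scaler_eq0 negb_or gt_eqF.
have way : in_chamber w (a *: y).
  by move=> s; rewrite actZ mxE mulr_ge0 ?(ltW a0)//; exact: wy.
rewrite (tits_invE ay0 way) (tits_invE y0 wy) /cone_weight_at actZ.
set x := act w^-1%g y; apply/funext => v.
have [[s ->]|vs] := pselect (exists s, v = vertex w s); last first.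
  by rewrite !cone_weight_out// => s e; apply: vs; exists s.
rewrite !cone_weight_vertex !mxE.
have -> : \sum_t `|(a *: x) 0 t| = a * \sum_t `|x 0 t|.
  rewrite mulr_sumr; apply: eq_bigr => t _.
  by rewrite mxE normrM gtr0_norm.
by rewrite -mulf_div divff ?mul1r// gt_eqF.
Qed.

End TitsConeMaps.

(** * Closed sets, pointwise convergence and compactness of simplices *)

Lemma cts_preimage_closed (T U : topologicalType) (f : T -> U) (D : set U) :
  continuous f -> closed D -> closed (f @^-1` D).
Proof. by move=> fc; apply: preimage_closed => t _; exact: fc. Qed.

Lemma ptws_continuous (R : realType) (T : topologicalType) (I : choiceType)
    (f : T -> {ptws I -> R}) :
  (forall i, continuous (fun t => f t i)) -> continuous f.
Proof.
move=> fc x; apply/cvg_sup => i; move: x.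
apply/(@continuousP _ (initial_topology (@^~ i))) => A [B oB <-].
by apply: (@open_comp _ _ (fun t => f t i)) => // t _; exact: fc.
Qed.

Lemma ptws_eval_continuous (R : realType) (I : choiceType) (i : I) :
  continuous (fun q : {ptws I -> R} => q i).
Proof. exact: (@proj_continuous I (fun=> R)). Qed.

Lemma ptws_closed1 (R : realType) (I : choiceType) (q : {ptws I -> R}) :
  closed [set q].
Proof.
have -> : [set q] = \bigcap_(i in [set: I]) [set q' : {ptws I -> R} | q' i = q i].
  apply/seteqP; split=> [_ -> //|q' e].
  by apply/funext => i; exact: e.
apply: closed_bigI => i _.
apply: (@cts_preimage_closed _ _ (fun q : {ptws I -> R} => q i) [set q i]).
  exact: ptws_eval_continuous.
exact: closed_eq.
Qed.

Lemma closed_cts_ge0 (R : realType) (T : topologicalType) (f : T -> R) :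
  continuous f -> closed [set t | 0 <= f t].
Proof.
by move=> fc; apply: (@cts_preimage_closed _ _ f [set x | 0 <= x]).
Qed.

Lemma std_simplex_compact (R : realType) n : compact (@std_simplex R n).
Proof.
have := @rV_compact R n.+1 (fun=> `[0, 1]%classic) (fun=> @segment_compact R 0 1).
move=> /(subclosed_compact _); apply.
  have -> : @std_simplex R n = \bigcap_(i in [set: 'I_n.+1]) [set x | 0 <= x 0 i] `&`
      (fun x => \sum_i x 0 i) @^-1` [set 1].
    apply/seteqP; split=> x /=; first by move=> [x0 x1]; split => // i _; exact: x0.
    by move=> [x0 x1]; split=> // i; exact: x0.
  apply: closedI.
    apply: closed_bigI => i _; apply: closed_cts_ge0; exact: coord_continuous.
  apply: cts_preimage_closed; last exact: closed_eq.
  by apply: cts_sum => i; exact: coord_continuous.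
move=> x [x0 x1] i /=; rewrite in_itv /= x0 -x1 (bigD1 i)//= lerDl.
by apply: sumr_ge0 => j _; exact: x0.
Qed.

Lemma std_simplex_increasing_cover (R : realType) n
    (U : nat -> set (@std_simplex R n)) :
  (forall k, open (U k)) -> (forall j k, (j <= k)%N -> U j `<=` U k) ->
  (forall a, exists k, U k a) -> exists k, forall a, U k a.
Proof.
move=> oU incU covU.
have /choice[B BP] k : exists B : set 'rV[R]_n.+1, open B /\ set_val @^-1` B = U k.
  by have [B oB BU] := oU k; exists B.
have := @std_simplex_compact R n; rewrite compact_cover.
move=> /(_ nat setT B (fun k _ => (BP k).1)) [|D _ DB].
  move=> x xs; have [k Uk] := covU (SigSub (mem_set xs)).
  by exists k => //; move: Uk; rewrite -(BP k).2.
exists (\max_(k <- D) k)%N => a; have /set_mem as_ := valP a.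
have [k kD Bk] := DB _ as_; apply: (incU k); first exact: leq_bigmax_seq.
by rewrite -(BP k).2.
Qed.

Section TitsConeTopology.
Variables (R : realType) (W : groupType) (S : {fset W}) (n : nat).
Variables (g : 'I_n.+1 -> W) (m : 'I_n.+1 -> 'I_n.+1 -> nat).
Hypothesis gP : indexed_coxeter_system g m.
Hypothesis gS : forall x, (x \in S) <-> exists s, g s = x.

Notation V := 'rV[R]_n.+1.
Notation act := (@act R W n g m gP).
Notation vertex := (vertex S g).
Notation complex := (coxeter_complex S).
Notation X := (realization R complex).
Notation tits_map := (@tits_map R W S n g m gP gS).
Notation tits_inv := (@tits_inv R W S n g m gP gS).
Implicit Types (s : 'I_n.+1) (w u : W) (x y : V) (p : X).

Lemma act_continuous w : continuous (act w : V -> V).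
Proof.
have [l <-] := word_prod_surj gP w; elim: l => [|s l IH].
  by move=> x; rewrite (_ : (act _ : V -> V) = idfun)//; apply/funext => y; exact: act1.
have -> : (act (word_prod g (s :: l)) : V -> V) = act (g s) \o act (word_prod g l).
  by apply/funext => x; rewrite /= actM.
move=> x; apply: continuous_comp; first exact: IH.
move: {IH} (act _ x); apply: rV_continuous => t.
under eq_fun do rewrite act_genE.
apply: cts_add; first exact: coord_continuous.
by apply: cts_mul; [exact: coord_continuous|exact: cst_continuous].
Qed.

Lemma realization_openE (V' : choiceType) (K : set (set V')) (U : set (realization R K)) :
  open U = realization_open U.
Proof. by []. Qed.

(** In the weak topology it suffices to work on one closed simplex, where a single w frames all
    points and the map is linear in finitely many weights. *)
Lemma tits_map_continuous : continuous tits_map.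
Proof.
apply/continuousP => U oU; rewrite realization_openE => sg /(coxeter_complexP gP gS R).
move=> [w [J [_ ->]]].
pose F (q : {ptws set W -> R}) : V := act w (\row_s q (vertex w s)).
exists (F @^-1` U).
  apply: open_comp oU => q _; apply: continuous_comp; last exact: act_continuous.
  move: q; apply: rV_continuous => s.
  have -> : (fun q : {ptws set W -> R} => (\row_s q (vertex w s)) 0 s) =
      (fun q => q (vertex w s)) by apply/funext => q; rewrite mxE.
  exact: ptws_eval_continuous.
suff h p : closed_simplex [set vertex w t | t in J] p -> tits_map p = F p.
  apply/seteqP; split=> p /= [Up sp]; split=> //; first by rewrite -h.
  by rewrite h.
move=> sp; rewrite (tits_mapE gP gS (w := w))//.
by move=> v /sp[s _ <-]; exists s.
Qed.

(** The parameter space is covered by finitely many closed pieces, one for each w in F, and on each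
    piece the weights are given by one continuous formula. Preimages of closed sets are thus finite
    unions of closed sets. *)
Lemma tits_inv_continuous (T : topologicalType) (f : T -> V) (F : set W) :
  finite_set F -> continuous f -> (forall t, f t != 0) ->
  (forall t, exists2 w, F w & in_chamber gP w (f t)) ->
  continuous (fun t => tits_inv (f t)).
Proof.
move=> finF fc f0 fF; apply/continuous_closedP => A cA.
have -> : (fun t => tits_inv (f t)) @^-1` A =
    \bigcup_(w in F) ([set t | in_chamber gP w (f t)] `&` (fun t => tits_inv (f t)) @^-1` A).
  apply/seteqP; split=> [t At|t [w _ [] //]].
  by have [w Fw wt] := fF t; exists w.
apply: closed_bigcup => // w _.
have af_continuous : continuous (fun t => act w^-1%g (f t)).
  by move=> t; apply: continuous_comp; [exact: fc|exact: act_continuous].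
have oA : realization_open (~` A) by rewrite -realization_openE openC.
(* The piece of w maps into the closed simplex on all vertices of w, where closedness can be tested
   with pointwise convergence of the weights. *)
have [|O oO AO] := oA [set vertex w s | s in [set: 'I_n.+1]].
  by apply/(coxeter_complexP gP gS R); exists w, setT; split => //; exists 0.
pose h t : {ptws set W -> R} := cone_weight_at S gP w (f t).
have -> : [set t | in_chamber gP w (f t)] `&` (fun t => tits_inv (f t)) @^-1` A =
    [set t | in_chamber gP w (f t)] `&` h @^-1` (~` O).
  have tw t : in_chamber gP w (f t) -> O (h t) <-> ~ A (tits_inv (f t)).
    move=> wt; have e := @tits_invE R W S n g m gP gS w (f t) (f0 t) wt.
    have sp : closed_simplex [set vertex w s | s in [set: 'I_n.+1]] (tits_inv (f t)).
      move=> v; rewrite /weight_support /= e => /cone_weight_framed[s ->].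
      by exists s.
    split=> [Oh|nA].
      suff : (~` A `&` closed_simplex [set vertex w s | s in [set: 'I_n.+1]]) (tits_inv (f t)) by case.
      by rewrite AO; split=> //=; rewrite e.
    have : (~` A `&` closed_simplex [set vertex w s | s in [set: 'I_n.+1]]) (tits_inv (f t)) by [].
    by rewrite AO => -[/=]; rewrite e.
  apply/seteqP; split=> t /= [wt].
    by move=> At; split=> // /(tw t wt).
  by move=> nO; split=> //; apply: contrapT => /(tw t wt).
apply: closedI.
  have -> : [set t | in_chamber gP w (f t)] =
      \bigcap_(s in [set: 'I_n.+1]) [set t | 0 <= act w^-1%g (f t) 0 s].
    by apply/seteqP; split=> [t wt s _|t wt s]; exact: wt.
  by apply: closed_bigI => s _; apply: closed_cts_ge0; exact: cts_coord.
apply: cts_preimage_closed; last exact: open_closedC.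
apply: ptws_continuous => v; apply: cts_div.
- apply: cts_sum => s; case: asboolP => _; last exact: cst_continuous.
  exact: cts_coord.
- by apply: cts_sum => s; apply: cts_norm; exact: cts_coord.
- by move=> t; rewrite gt_eqF// norm1_neq0// act_neq0.
Qed.

(** Otherwise there are parameters [a N] whose images have only frames of length greater than N.
    Their images meet each closed simplex finitely often, so the complements of the tails are open
    and cover; compactness makes one tail miss the image, which is absurd. *)
Lemma simplex_bounded_chambers k (s : @std_simplex R k -> X) : continuous s ->
  exists N, forall a, exists2 w, (len gP w <= N)%N & framed (S := S) g (s a) w.
Proof.
move=> sc; apply: contrapT => nN.
have /choice[a aP] N : exists a, forall w, framed (S := S) g (s a) w -> (N < len gP w)%N.
  apply: contrapT => na; apply: nN; exists N => a; apply: contrapT => nw.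
  apply: na; exists a => w wa; rewrite ltnNge; apply/negP => wN.
  by apply: nw; exists w.
pose U k : set X := [set p | forall j, (k <= j)%N -> p <> s (a j)].
have oU i : open (U i).
  rewrite realization_openE => sg /(coxeter_complexP gP gS R)[w [J [_ ->]]].
  (* A point [s (a j)] in this closed simplex is framed by w, so j < len w: only finitely many
     points have to be removed. *)
  pose Z : set {ptws set W -> R} := \bigcup_(j in `I_(len gP w)) 
    (if (i <= j)%N then [set (weight (s (a j)) : {ptws set W -> R})] else set0).
  exists (~` Z).
    apply: closed_openC; apply: closed_bigcup; first exact: finite_II.
    move=> j _; case: ifP => _; [exact: ptws_closed1|exact: closed0].
  apply/seteqP; split=> p /= [Up sp]; split=> //.
    move=> [j _]; case: ifP => // ij /= e.
    by apply: (Up j ij); exact: realization_ext.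
  move=> j ij e; apply: Up; exists j; last by rewrite ij e.
  apply: aP; rewrite -e => v /sp[t _ <-]; by exists t.
have [|||k0 k0P] := @std_simplex_increasing_cover R k (fun i => s @^-1` U i).
- by move=> i; apply: open_comp (oU i) => b _; exact: sc.
- by move=> i j ij b Ub l jl; apply: Ub; exact: leq_trans jl.
- move=> b; have [w wb] := framed_ex gP gS (s b); exists (len gP w) => j wj e.
  by have := aP j w; rewrite -e => /(_ wb); rewrite ltnNge wj.
by have := k0P (a k0) k0 (leqnn _).
Qed.

End TitsConeTopology.

(** * Cohomology of the Coxeter complex *)

Section CoxeterComplexCohomology.
Variables (R : realType) (W : groupType) (S : {fset W}) (n : nat).
Variables (g : 'I_n.+1 -> W) (m : 'I_n.+1 -> 'I_n.+1 -> nat).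
Hypothesis gP : indexed_coxeter_system g m.
Hypothesis gS : forall x, (x \in S) <-> exists s, g s = x.

Notation V := 'rV[R]_n.+1.
Notation act := (@act R W n g m gP).
Notation X := (realization R (coxeter_complex S)).
Notation tits_map := (@tits_map R W S n g m gP gS).
Notation tits_inv := (@tits_inv R W S n g m gP gS).

Let enorm (y : V) : R := Num.sqrt (\sum_i y 0 i ^+ 2).

Let enorm_gt0 y : y != 0 -> 0 < enorm y.
Proof.
move=> y0; rewrite sqrtr_gt0 lt_neqAle sumr_ge0 ?andbT => [|i _]; last exact: sqr_ge0.
rewrite eq_sym; apply: contra_neq y0 => /eqP.
rewrite psumr_eq0 => [/allP h|i _]; last exact: sqr_ge0.
apply/rowP => i; rewrite mxE; apply/eqP; rewrite -sqrf_eq0.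
by apply: (implyP (h i _)); rewrite ?mem_index_enum.
Qed.

Let enormZ (a : R) y : 0 < a -> enorm (a *: y) = a * enorm y.
Proof.
move=> a0; rewrite /enorm; under eq_bigr do rewrite mxE exprMn.
by rewrite -mulr_sumr sqrtrM ?sqr_ge0// sqrtr_sqr gtr0_norm.
Qed.

Let normalize (y : V) : V := (enorm y)^-1 *: y.

Let normalize_sphere y : y != 0 -> normalize y \in sphere R n.
Proof.
move=> y0; have e0 := enorm_gt0 y0; apply/mem_set; rewrite /sphere /=.
under eq_bigr do rewrite mxE exprMn.
rewrite -mulr_sumr exprVn -[X in _ * X]sqr_sqrtr; last first.
  by apply: sumr_ge0 => i _; exact: sqr_ge0.
by rewrite mulVf// sqrf_eq0 gt_eqF.
Qed.

Let sphere_enorm (y : sphere R n) : enorm (set_val y) = 1.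
Proof. by have /set_mem := valP y; rewrite /sphere /enorm /= => ->; rewrite sqrtr1. Qed.

Let sphere_neq0 (y : sphere R n) : set_val y != 0.
Proof.
apply/eqP => y0; have := sphere_enorm y; rewrite y0 /enorm big1 ?sqrtr0.
  by move=> /eqP; rewrite eq_sym oner_eq0.
by move=> i _; rewrite mxE expr0n.
Qed.

Lemma finite_coxeter_complex_sphere :
  finite_set [set: W] -> same_cohomology R X (sphere R n).
Proof.
move=> finW; have inC (y : V) : exists2 w, [set: W] w & in_chamber gP w y.
  by have [w wy] := @tits_cone_full R W n g m gP finW y; exists w.
pose f (p : X) : sphere R n := SigSub (normalize_sphere (tits_map_neq0 gP gS p)).
pose h (y : sphere R n) : X := tits_inv (set_val y).
apply: (@same_cohomology_homeomorphism R X (sphere R n) f h).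
- apply: set_type_continuous; apply: rV_continuous => i.
  under eq_fun do rewrite set_valE /= mxE mulrC.
  have tc j : continuous (fun p => tits_map p 0 j).
    exact/cts_coord/tits_map_continuous.
  apply: cts_div => // [p|p]; last by rewrite gt_eqF// enorm_gt0// tits_map_neq0.
  apply: (@continuous_comp _ _ _ (fun p => \sum_i tits_map p 0 i ^+ 2)).
    by apply: cts_sum => j; under eq_fun do rewrite expr2; exact: cts_mul.
  exact: sqrt_continuous.
- apply: (tits_inv_continuous (F := setT)) => //; exact: set_val_continuous.
- move=> p; rewrite /h /f set_valE /=; have [w _ wp] := inC (tits_map p).
  rewrite (tits_invZ gS _ _ wp) ?tits_mapK ?tits_map_neq0// invr_gt0.
  by rewrite enorm_gt0// tits_map_neq0.
- move=> y; apply: val_inj => /=; have [w _ wy] := inC (set_val y).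
  have [a a0 e] := tits_invK gS (sphere_neq0 y) wy.
  rewrite /h /normalize e enormZ// sphere_enorm mulr1 scalerA mulVf ?scale1r//.
  by rewrite gt_eqF.
Qed.

Let ones : V := const_mx 1.

Let ray (p : X) (l : R) : V := l *: ones + (1 - l) *: tits_map p.

Lemma infinite_coxeter_complex_point :
  infinite_set [set: W] -> same_cohomology R X (point_space R).
Proof.
move=> infW; apply: (@same_cohomology_point R X (fun p l => tits_inv (ray p l))
  (tits_inv ones)) => [p|p|k s l sc lc l01].
- by rewrite /ray scale0r add0r subr0 scale1r tits_mapK.
- by rewrite /ray subrr scale0r addr0 scale1r.
have onesC : chamber ones := @ones_chamber R n.
have [N sN] := simplex_bounded_chambers gP gS sc.
apply: (tits_inv_continuous (F := [set w | (len gP w <= N)%N])).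
- exact: finite_len_le.
- apply: rV_continuous => i; under eq_fun do rewrite !mxE mulr1.
  apply: cts_add => //; apply: cts_mul; first exact/cts_sub/lc/cst_continuous.
  apply: cts_coord => a; apply: continuous_comp; first exact: sc.
  exact: tits_map_continuous.
- move=> a; apply/eqP => r0; have /andP[l0 l1] := l01 a.
  have [w _ wa] := sN a; have wC := @coords_chamber R W S n g w (s a).
  move: r0; rewrite /ray (tits_mapE gP gS wa); set x := coords _ _ _ in wC *.
  have [la|la r0] := eqVneq (l a) 0.
    rewrite la scale0r add0r subr0 scale1r -(tits_mapE gP gS wa) => /eqP.
    by rewrite (negbTE (tits_map_neq0 gP gS _)).
  have {}l0 : 0 < l a by rewrite lt_neqAle eq_sym la.
  (* A zero of the segment at positive time makes -[ones] the image under w of a chamber vector,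
     which forces W to be finite. *)
  apply: infW.
  have : (l a)^-1 *: (l a *: ones + (1 - l a) *: act w x) = 0 by rewrite r0 scaler0.
  rewrite scalerDr !scalerA mulVf// scale1r addrC -actZ => /eqP.
  rewrite addr_eq0 => /eqP wx.
  apply: (@finite_of_opposite R W n g m gP ones _ w _ _ wx) => i.
    by rewrite mxE.
  by rewrite mxE mulr_ge0 ?wC// mulr_ge0 ?subr_ge0// invr_ge0 ltW.
(* The segment from [ones] to a point of chamber w meets only chambers of length at most len w, so
   the bound N for the simplex serves for its whole contraction. *)
- move=> a; have [w wN wa] := sN a; have /andP[l0 l1] := l01 a.
  have l1' : 0 <= 1 - l a by rewrite subr_ge0.
  have [u [uw uC]] := @segment_chambers R W n g m gP ones _ w (l a) (1 - l a)
    onesC (@coords_chamber R W S n g w (s a)) l0 l1'.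
  exists u; first exact: leq_trans wN.
  by rewrite /in_chamber /ray (tits_mapE gP gS wa).
Qed.

End CoxeterComplexCohomology.

(** Non-emptiness of S makes the index type ['I_(#|S| - 1).+1] have exactly as many elements as S,
    so that the sphere in R^S has dimension |S| - 1. *)
Lemma coxeter_system_index (W : groupType) (S : {fset W}) :
  coxeter_system S -> S != fset0 ->
  exists (g : 'I_(#|` S| - 1).+1 -> W) m, indexed_coxeter_system g m /\
    forall x, (x \in S) <-> exists s, g s = x.
Proof.
move=> [m [[m1 mC mN] [mR mU]]] S0.
have cS : (#|` S| - 1).+1 = #|{: S}|.
  by rewrite cardfE -cardfE subn1 prednK// lt0n cardfs_eq0.
pose e (i : 'I_(#|` S| - 1).+1) : S := enum_val (cast_ord cS i).
pose e' (x : S) : 'I_(#|` S| - 1).+1 := cast_ord (esym cS) (enum_rank x).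
have eK : cancel e e' by move=> i; rewrite /e' enum_valK cast_ordK.
have e'K : cancel e' e by move=> x; rewrite /e cast_ordKV enum_rankK.
exists (val \o e), (fun s t => m (e s) (e t)); split; last first.
  move=> x; split=> [xS|[s <-]]; last exact: valP.
  by exists (e' [` xS]%fset); rewrite /= e'K.
split.
- split=> [s|s t|s t st]; [exact: m1|exact: mC|apply: mN].
  by rewrite (can_eq eK).
- by move=> s t; exact: mR.
- move=> G f fR; have [|h [[hM hf] hu]] := mU G (f \o e').
    by move=> s t; have := fR (e' s) (e' t); rewrite !e'K.
  exists h; split; first by split=> // s; rewrite /= hf /= eK.
  move=> h' [h'M h'f]; apply: hu; split=> // x.
  by rewrite -{1}[x]e'K; exact: h'f.
Qed.

Theorem mainTheorem9 (R : realType) (W : groupType) (S : {fset W})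
    (WS : coxeter_system S) (S_neq0 : S != fset0) :
  (finite_set [set: W] ->
    same_cohomology R (realization R (coxeter_complex S))
                      (sphere R (#|` S| - 1))) /\
  (infinite_set [set: W] ->
    same_cohomology R (realization R (coxeter_complex S)) (point_space R)).
Proof.
have [g [m [gP gS]]] := coxeter_system_index WS S_neq0.
split; first exact: finite_coxeter_complex_sphere gP gS.
exact: infinite_coxeter_complex_point gP gS.
Qed.
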